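(* Suppose the metric space $(X,d_X)$ can be isometrically embedded in the metric space $(Y,d_Y)$. Then for any metric triple $T$ in $(X,d_X)$, regarded also as a metric triple in $(Y,d_Y)$ via the embedding, we have $k_Y(T)\le k_X(T)$.
   Context: **Model spaces.** For a real number $k$, $M_k^2$ with distance $|\cdot|_k$ is the simply connected complete surface of constant curvature $k$ (the Euclidean plane for $k=0$; the unit sphere with distance multiplied by $1/\sqrt{k}$ for $k>0$; the hyperbolic plane with distance multiplied by $1/\sqrt{-k}$ for $k<0$). **The function $S$.** Let $a,b,c\in(0,\infty)$ with $a\le b\le c\le a+b$ and $k\in(-\infty,(\frac{2\pi}{a+b+c})^2]$. There is a triangle $\Delta ABC$ in $M_k^2$ with $|BC|_k=a$, $|AC|_k=b$, $|AB|_k=c$, and one sets $S(a,b,c,k)=\min_{P\in\Delta ABC}\{|PA|_k+|PB|_k+|PC|_k\}$, where $P$ ranges over the closed triangular region; the value is independent of the choice of triangle. $S$ is extended to be symmetric in $a,b,c$. Convention: $S(a,b,c,-\infty)=\lim_{k\to-\infty}S(a,b,c,k)=\frac{a+b+c}{2}$. **The number $\Lambda(a,b,c)$.** For $a\le b\le c\le a+b$, $\Lambda(a,b,c)=k^*$ where: $k^*=0$ if $c^2=a^2+b^2+ab$; if $c^2<a^2+b^2+ab$, $k^*\in(0,(\frac{2\pi}{a+b+c})^2]$ is the number with $\cos(c\sqrt{k^*})=\cos(a\sqrt{k^*})\cos(b\sqrt{k^*})-\frac12\sin(a\sqrt{k^*})\sin(b\sqrt{k^*})$; if $c^2>a^2+b^2+ab$,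 $k^*<0$ is the number with $\cosh(c\sqrt{-k^*})=\cosh(a\sqrt{-k^*})\cosh(b\sqrt{-k^*})+\frac12\sinh(a\sqrt{-k^*})\sinh(b\sqrt{-k^*})$. Convention: $\Lambda(a,b,c)=-\infty$ if $c=a+b$. **Curvature of a triple.** A metric triple in a metric space $(X,d)$ is a set $T=\{p_1,p_2,p_3\}\subseteq X$ of three distinct points with mutual distances $d_{ij}=d(p_i,p_j)$, labelled so that $d_{12}\le d_{23}\le d_{13}\le d_{12}+d_{23}$. Put $g_X(T)=\inf_{x\in X}\sum_{i=1}^3 d(p_i,x)$. The curvature $k_X(T)$ is the number $k\in[-\infty,\Lambda(d_{12},d_{23},d_{13})]$ such that $g_X(T)=S(d_{12},d_{23},d_{13},k)$. *)

(* Defs.v *)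
From Stdlib Require Import Reals Lra ClassicalEpsilon.
From Coquelicot Require Import Coquelicot.
Open Scope R_scope.

(** * Model surfaces

    All of them sit in [R^3]: the plane [z = 1] for [k = 0], the unit sphere
    for [k > 0], the upper sheet of the hyperboloid [z^2 - x^2 - y^2 = 1] for
    [k < 0].  In each of them the geodesics are the intersections with linear
    planes through the origin. *)

Record vec3 : Type := Vec3 { vx : R; vy : R; vz : R }.

Definition dot (P Q : vec3) : R := vx P * vx Q + vy P * vy Q + vz P * vz Q.

Definition lorentz (P Q : vec3) : R := vz P * vz Q - vx P * vx Q - vy P * vy Q.

Definition arcosh (t : R) : R := ln (t + sqrt (t ^ 2 - 1)).

Definition on_model (k : R) (P : vec3) : Prop :=
  (k = 0 -> vz P = 1) /\
  (0 < k -> dot P P = 1) /\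
  (k < 0 -> 0 < vz P /\ lorentz P P = 1).

Definition model_dist (k : R) (P Q : vec3) : R :=
  if Rlt_dec 0 k then acos (dot P Q) / sqrt k
  else if Rlt_dec k 0 then arcosh (lorentz P Q) / sqrt (- k)
  else sqrt ((vx P - vx Q) ^ 2 + (vy P - vy Q) ^ 2).

(** * Triangles and the function [S] *)

Definition perimeter (k : R) (A B C : vec3) : R :=
  model_dist k B C + model_dist k A C + model_dist k A B.

Definition in_cone (A B C P : vec3) : Prop :=
  exists u v w : R, 0 <= u /\ 0 <= v /\ 0 <= w /\
    P = Vec3 (u * vx A + v * vx B + w * vx C)
             (u * vy A + v * vy B + w * vy C)
             (u * vz A + v * vz B + w * vz C).

(** [triangular_region k A B C D]: [D] is a closed region bounded by the
    triangle [ABC].  It is the geodesic convex hull of the vertices (the trace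
    of their linear cone), except when [k > 0] and the perimeter takes its
    maximal value [2 pi / sqrt k]: the triangle is then a whole great circle
    and [D] is one of the two closed hemispheres it bounds, [N] being its
    pole. *)
Inductive triangular_region (k : R) (A B C : vec3) : (vec3 -> Prop) -> Prop :=
| region_hull :
    (0 < k -> perimeter k A B C < 2 * PI / sqrt k) ->
    triangular_region k A B C (fun P => on_model k P /\ in_cone A B C P)
| region_hemisphere (N : vec3) :
    0 < k -> perimeter k A B C = 2 * PI / sqrt k ->
    on_model k N -> dot N A = 0 -> dot N B = 0 -> dot N C = 0 ->
    triangular_region k A B C (fun P => on_model k P /\ 0 <= dot N P).

Definition dist_sum (k : R) (A B C P : vec3) : R :=
  model_dist k P A + model_dist k P B + model_dist k P C.

Definition is_S (a b c k s : R) : Prop :=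
  exists (A B C : vec3) (D : vec3 -> Prop),
    on_model k A /\ on_model k B /\ on_model k C /\
    model_dist k B C = a /\ model_dist k A C = b /\ model_dist k A B = c /\
    triangular_region k A B C D /\
    (exists P, D P /\ dist_sum k A B C P = s) /\
    (forall P, D P -> s <= dist_sum k A B C P).

Definition S_fin (a b c k : R) : R := epsilon (inhabits 0) (is_S a b c k).

(** The value at [p_infty] is irrelevant: curvatures are never [p_infty]. *)
Definition S_ext (a b c : R) (k : Rbar) : R :=
  match k with
  | Finite k => S_fin a b c k
  | m_infty => (a + b + c) / 2
  | p_infty => 0
  end.

(** * The upper bound [Lambda], for [a <= b <= c <= a + b] *)

Inductive is_Lambda (a b c : R) : Rbar -> Prop :=
| Lambda_degenerate :
    c = a + b -> is_Lambda a b c m_infty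
| Lambda_zero :
    c < a + b -> c ^ 2 = a ^ 2 + b ^ 2 + a * b -> is_Lambda a b c (Finite 0)
| Lambda_pos (k : R) :
    c < a + b -> c ^ 2 < a ^ 2 + b ^ 2 + a * b ->
    0 < k <= (2 * PI / (a + b + c)) ^ 2 ->
    cos (c * sqrt k) =
      cos (a * sqrt k) * cos (b * sqrt k)
      - / 2 * (sin (a * sqrt k) * sin (b * sqrt k)) ->
    is_Lambda a b c (Finite k)
| Lambda_neg (k : R) :
    c < a + b -> a ^ 2 + b ^ 2 + a * b < c ^ 2 ->
    k < 0 ->
    cosh (c * sqrt (- k)) =
      cosh (a * sqrt (- k)) * cosh (b * sqrt (- k))
      + / 2 * (sinh (a * sqrt (- k)) * sinh (b * sqrt (- k))) ->
    is_Lambda a b c (Finite k).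

Definition Lambda (a b c : R) : Rbar :=
  epsilon (inhabits m_infty) (is_Lambda a b c).

(** * Curvature of metric triples *)

Record metric_triple (X : Metric_Space) : Type := MetricTriple {
  pt1 : Base X; pt2 : Base X; pt3 : Base X;
  pt12_neq : pt1 <> pt2;
  pt23_neq : pt2 <> pt3;
  pt13_neq : pt1 <> pt3;
  d12_le_d23 : dist X pt1 pt2 <= dist X pt2 pt3;
  d23_le_d13 : dist X pt2 pt3 <= dist X pt1 pt3 }.

Arguments MetricTriple {X}.
Arguments pt1 {X} _.
Arguments pt2 {X} _.
Arguments pt3 {X} _.
Arguments pt12_neq {X} _ _.
Arguments pt23_neq {X} _ _.
Arguments pt13_neq {X} _ _.
Arguments d12_le_d23 {X} _.
Arguments d23_le_d13 {X} _.

Definition g_inf (X : Metric_Space) (T : metric_triple X) : R :=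
  real (Glb_Rbar (fun s => exists x : Base X,
    s = dist X (pt1 T) x + dist X (pt2 T) x + dist X (pt3 T) x)).

Definition is_curvature (X : Metric_Space) (T : metric_triple X) (k : Rbar)
    : Prop :=
  let d12 := dist X (pt1 T) (pt2 T) in
  let d23 := dist X (pt2 T) (pt3 T) in
  let d13 := dist X (pt1 T) (pt3 T) in
  Rbar_le k (Lambda d12 d23 d13) /\ g_inf X T = S_ext d12 d23 d13 k.

Definition isometric_embedding (X Y : Metric_Space) (f : Base X -> Base Y)
    : Prop :=
  forall x y : Base X, dist Y (f x) (f y) = dist X x y.

Lemma isometric_embedding_neq (X Y : Metric_Space) (f : Base X -> Base Y) :
  isometric_embedding X Y f -> forall x y, x <> y -> f x <> f y.
Proof.
intros Hf x y Hxy E; apply Hxy, (dist_refl X); rewrite <- (Hf x y).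
now apply (dist_refl Y).
Qed.

Lemma isometric_embedding_le (X Y : Metric_Space) (f : Base X -> Base Y) :
  isometric_embedding X Y f ->
  forall x y z t, dist X x y <= dist X z t ->
  dist Y (f x) (f y) <= dist Y (f z) (f t).
Proof. intros Hf x y z t H; now rewrite !Hf. Qed.

Definition image_triple (X Y : Metric_Space) (f : Base X -> Base Y)
    (Hf : isometric_embedding X Y f) (T : metric_triple X) : metric_triple Y :=
  MetricTriple (f (pt1 T)) (f (pt2 T)) (f (pt3 T))
    (isometric_embedding_neq X Y f Hf _ _ (pt12_neq T))
    (isometric_embedding_neq X Y f Hf _ _ (pt23_neq T))
    (isometric_embedding_neq X Y f Hf _ _ (pt13_neq T))
    (isometric_embedding_le X Y f Hf _ _ _ _ (d12_le_d23 T))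
    (isometric_embedding_le X Y f Hf _ _ _ _ (d23_le_d13 T)).

(* Main.v *)
Require Import Defs.
From Stdlib Require Import Reals Lra ClassicalEpsilon List.
From Coquelicot Require Import Coquelicot.
Open Scope R_scope.

(** The infimum defining [g_inf] is taken over more points in the larger space,
    so it can only be smaller there.  The theorem therefore says that
    [S a b c] is strictly increasing in [k] from [m_infty] to [Lambda a b c]
    ([S_ext_strict_mono]).

    Let [k1 < k2 <= Lambda], and let [P] minimise the sum of the distances
    [x1], [x2], [x3] to the vertices of a triangle of curvature [k2].  A point
    with a smaller sum is needed in any triangle of curvature [k1] with the same
    sides.

    If [P] is neither a vertex nor the antipode of one, this is a case of
    Kirszbraun's theorem ([kirszbraun_triangle]): there is a point of the second
    triangle whose distances to the vertices are at most the [x_i], and not all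
    equal to them.  The reason is that the comparison angle of a triangle with
    given sides increases with the curvature ([angle_cos_mono]).  Hence the
    quadratic form with coefficients
    [sn k xi * sn k xj * cos (angle ij)], which for [k2] is the Gram form of
    three vectors tangent at [P], is for [k1] still nonnegative on nonnegative
    weights.  Its nonnegativity is what a minimax argument over the barycentric
    weights of the second triangle needs ([minimax_barycentre]).  Equality of
    all the distances would make all the comparison triangles degenerate, which
    is impossible as [c < a + b].

    If [P] is a vertex or the antipode of one, the sum is at least [a + b]
    ([vertex_or_generic]).  The angle at [C] is [2 * PI / 3] for the curvature
    [Lambda], so it is smaller for [k1], and moving from [C] along the bisector
    gives a sum less than [a + b] ([vertex_not_min]).

    The three geometries are treated at once.  Distances enter through
    [ms k t = (1 - cs k t) / k], and points through nonnegative weights on the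
    vertices in [R^3]; the distances from such a point to the vertices depend
    only on the weights and on the sides ([chord_comb]). *)

(** * Generalised trigonometry of the model surfaces *)

(** The solution of [y'' = - k y] with [y 0 = 0] and [y' 0 = 1]: the trigonometry
    of all the model surfaces is written with it, so that proofs that use only
    its addition and derivative formulas are the same for every [k]. *)
Definition sn (k t : R) : R :=
  if Rlt_dec 0 k then sin (t * sqrt k) / sqrt k
  else if Rlt_dec k 0 then sinh (t * sqrt (- k)) / sqrt (- k)
  else t.

Definition cs (k t : R) : R :=
  if Rlt_dec 0 k then cos (t * sqrt k)
  else if Rlt_dec k 0 then cosh (t * sqrt (- k))
  else 1.

(** This is [(1 - cs k t) / k], and [t ^ 2 / 2] for [k = 0].  Unlike [cs], it
    determines the distance [t] for every [k], so it replaces [cs] in the law of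
    cosines. *)
Definition ms (k t : R) : R := 2 * sn k (t / 2) ^ 2.

(** Lengths below, or up to, the diameter [PI / sqrt k] of the surface; no
    condition for [k <= 0]. *)
Definition short (k t : R) : Prop := 0 < k -> t * sqrt k < PI.
Definition short_le (k t : R) : Prop := 0 < k -> t * sqrt k <= PI.

Lemma sinh_plus x y : sinh (x + y) = sinh x * cosh y + cosh x * sinh y.
Proof.
unfold sinh, cosh; rewrite Ropp_plus_distr, !exp_plus; field.
Qed.

Lemma cosh_plus x y : cosh (x + y) = cosh x * cosh y + sinh x * sinh y.
Proof.
unfold sinh, cosh; rewrite Ropp_plus_distr, !exp_plus; field.
Qed.

Ltac curvature_cases k :=
  destruct (Rlt_dec 0 k) as [Hk|Hk];
  [| destruct (Rlt_dec k 0) as [Hk'|Hk']; [| assert (k = 0) by lra; subst k]].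

Ltac sqrt_facts k :=
  match goal with
  | H : 0 < k |- _ =>
      assert (0 < sqrt k) by (apply sqrt_lt_R0; lra);
      assert (sqrt k * sqrt k = k) by (apply sqrt_sqrt; lra)
  | H : k < 0 |- _ =>
      assert (0 < sqrt (- k)) by (apply sqrt_lt_R0; lra);
      assert (sqrt (- k) * sqrt (- k) = - k) by (apply sqrt_sqrt; lra)
  end.

Lemma sn_0 k : sn k 0 = 0.
Proof.
unfold sn; curvature_cases k; try sqrt_facts k.
- rewrite Rmult_0_l, sin_0; field; lra.
- rewrite Rmult_0_l; unfold sinh; rewrite Ropp_0; field; lra.
- reflexivity.
Qed.

Lemma cs_0 k : cs k 0 = 1.
Proof.
unfold cs; curvature_cases k; rewrite ?Rmult_0_l; auto using cos_0.
unfold cosh; rewrite Ropp_0, exp_0; field.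
Qed.

Lemma sn_opp k t : sn k (- t) = - sn k t.
Proof.
unfold sn; curvature_cases k; try sqrt_facts k.
- rewrite Ropp_mult_distr_l_reverse, sin_neg; field; lra.
- rewrite Ropp_mult_distr_l_reverse; unfold sinh; rewrite Ropp_involutive.
  field; lra.
- reflexivity.
Qed.

Lemma cs_opp k t : cs k (- t) = cs k t.
Proof.
unfold cs; curvature_cases k; rewrite ?Ropp_mult_distr_l_reverse.
- apply cos_neg.
- unfold cosh; rewrite Ropp_involutive; field.
- reflexivity.
Qed.

Lemma sn_plus k x y : sn k (x + y) = sn k x * cs k y + cs k x * sn k y.
Proof.
unfold sn, cs; curvature_cases k; try sqrt_facts k.
- rewrite Rmult_plus_distr_r, sin_plus; field; lra.
- rewrite Rmult_plus_distr_r, sinh_plus; field; lra.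
- ring.
Qed.

Lemma cs_plus k x y : cs k (x + y) = cs k x * cs k y - k * (sn k x * sn k y).
Proof.
unfold sn, cs; curvature_cases k; try sqrt_facts k.
- rewrite Rmult_plus_distr_r, cos_plus.
  rewrite <- H0 at 7; field; lra.
- rewrite Rmult_plus_distr_r, cosh_plus.
  replace k with (- (sqrt (- k) * sqrt (- k))) at 7 by lra; field; lra.
- ring.
Qed.

Lemma sn_minus k x y : sn k (x - y) = sn k x * cs k y - cs k x * sn k y.
Proof. unfold Rminus; rewrite sn_plus, sn_opp, cs_opp; ring. Qed.

Lemma cs_sn_sqr k t : cs k t ^ 2 = 1 - k * sn k t ^ 2.
Proof.
assert (H := cs_plus k t (- t)).
rewrite Rplus_opp_r, cs_0, sn_opp, cs_opp in H; lra.
Qed.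

Lemma sn_double k t : sn k t = 2 * (sn k (t / 2) * cs k (t / 2)).
Proof. replace t with (t / 2 + t / 2) at 1 by field; rewrite sn_plus; ring. Qed.

Lemma cs_ms k t : cs k t = 1 - k * ms k t.
Proof.
replace t with (t / 2 + t / 2) at 1 by field; rewrite cs_plus; unfold ms.
assert (H := cs_sn_sqr k (t / 2)); lra.
Qed.

Lemma sn_ms_sqr k t : sn k t ^ 2 = 2 * ms k t - k * ms k t ^ 2.
Proof.
rewrite sn_double; unfold ms; assert (H := cs_sn_sqr k (t / 2)).
replace ((2 * _) ^ 2) with (4 * sn k (t / 2) ^ 2 * cs k (t / 2) ^ 2) by ring.
rewrite H; ring.
Qed.

Lemma sn_sqr_minus k x y :
  sn k x ^ 2 - sn k y ^ 2 = sn k (x + y) * sn k (x - y).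
Proof.
rewrite sn_plus, sn_minus.
replace ((_ + _) * _) with (sn k x ^ 2 * cs k y ^ 2 - cs k x ^ 2 * sn k y ^ 2)
  by ring.
rewrite !cs_sn_sqr; ring.
Qed.

Lemma ms_minus k x y :
  ms k x - ms k y = 2 * (sn k ((x + y) / 2) * sn k ((x - y) / 2)).
Proof.
unfold ms.
replace ((x + y) / 2) with (x / 2 + y / 2) by field.
replace ((x - y) / 2) with (x / 2 - y / 2) by field.
rewrite <- sn_sqr_minus; ring.
Qed.

Lemma ms_diff k x y :
  ms k (x - y) = ms k x + ms k y - k * (ms k x * ms k y) - sn k x * sn k y.
Proof.
rewrite (sn_double k x), (sn_double k y); unfold ms.
replace ((x - y) / 2) with (x / 2 - y / 2) by field; rewrite sn_minus.
assert (Hx := cs_sn_sqr k (x / 2)); assert (Hy := cs_sn_sqr k (y / 2)).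
replace ((_ - _) ^ 2) with
  (sn k (x / 2) ^ 2 * cs k (y / 2) ^ 2 + cs k (x / 2) ^ 2 * sn k (y / 2) ^ 2
   - 2 * (sn k (x / 2) * cs k (x / 2) * (sn k (y / 2) * cs k (y / 2)))) by ring.
rewrite Hx, Hy; ring.
Qed.

Lemma ms_opp k x : ms k (- x) = ms k x.
Proof.
unfold ms; replace (- x / 2) with (- (x / 2)) by field; rewrite sn_opp; ring.
Qed.

Lemma ms_0 k : ms k 0 = 0.
Proof. unfold ms; replace (0 / 2) with 0 by field; rewrite sn_0; ring. Qed.

Lemma is_derive_sn k t : is_derive (sn k) t (cs k t).
Proof.
unfold sn, cs; curvature_cases k; try sqrt_facts k.
- auto_derive; [trivial | field; lra].
- apply (is_derive_ext (fun t => (exp (t * sqrt (- k)) - exp (- (t * sqrt (- k))))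
     / 2 / sqrt (- k))); [reflexivity |].
  unfold cosh; auto_derive; [trivial | field; lra].
- apply (is_derive_id (K := R_AbsRing)).
Qed.

Lemma is_derive_cs k t : is_derive (cs k) t (- (k * sn k t)).
Proof.
unfold sn, cs; curvature_cases k; try sqrt_facts k.
- auto_derive; [trivial | rewrite <- H0 at 3; field; lra].
- apply (is_derive_ext
    (fun t => (exp (t * sqrt (- k)) + exp (- (t * sqrt (- k)))) / 2));
    [reflexivity |].
  unfold sinh; auto_derive; [trivial |].
  replace k with (- (sqrt (- k) * sqrt (- k))) at 5 by lra; field; lra.
- replace (- (0 * t)) with 0 by ring.
  apply (is_derive_const (K := R_AbsRing) (V := R_NormedModule)).
Qed.

Lemma is_derive_ms k t : is_derive (ms k) t (sn k t).
Proof.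
unfold ms; rewrite sn_double.
evar_last.
{ apply is_derive_scal, is_derive_pow.
  apply (is_derive_comp (sn k) (fun t => t / 2)); [apply is_derive_sn |].
  auto_derive; [trivial | reflexivity]. }
simpl; unfold scal; simpl; unfold mult; simpl; field.
Qed.

Lemma short_le_of k x y : x <= y -> short_le k y -> short_le k x.
Proof.
intros H Hy Hk; apply Rle_trans with (2 := Hy Hk).
apply Rmult_le_compat_r; [apply sqrt_pos | lra].
Qed.

Lemma short_of k x y : x <= y -> short k y -> short k x.
Proof.
intros H Hy Hk; apply Rle_lt_trans with (2 := Hy Hk).
apply Rmult_le_compat_r; [apply sqrt_pos | lra].
Qed.

Lemma short_of_lt k x y : x < y -> short_le k y -> short k x.
Proof.
intros H Hy Hk; apply Rlt_le_trans with (2 := Hy Hk).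
apply Rmult_lt_compat_r; [apply sqrt_lt_R0 |]; lra.
Qed.

Lemma short_weak k x : short k x -> short_le k x.
Proof. intros H Hk; left; auto. Qed.

Lemma short_curvature k k' x :
  k <= k' -> 0 <= x -> short k' x -> short k x.
Proof.
intros H Hx Hy Hk; apply Rle_lt_trans with (x * sqrt k'); [| apply Hy; lra].
apply Rmult_le_compat_l; [lra |]; apply sqrt_le_1; lra.
Qed.

Lemma sinh_pos x : 0 < x -> 0 < sinh x.
Proof.
intros H; unfold sinh; assert (exp (- x) < exp x) by (apply exp_increasing; lra).
lra.
Qed.

Lemma sn_pos k t : 0 < t -> short k t -> 0 < sn k t.
Proof.
intros Ht Hw; unfold sn, short in *; curvature_cases k; try sqrt_facts k; auto.
- apply Rdiv_lt_0_compat; auto; apply sin_gt_0; auto.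
  apply Rmult_lt_0_compat; auto.
- apply Rdiv_lt_0_compat; auto; apply sinh_pos; apply Rmult_lt_0_compat; auto.
Qed.

Lemma ms_incr k x y : 0 <= x -> x < y -> short_le k y -> ms k x < ms k y.
Proof.
intros Hx Hxy Hy; apply Rminus_lt_0; rewrite ms_minus.
apply Rmult_lt_0_compat; [lra |].
apply Rmult_lt_0_compat; apply sn_pos; try lra;
  (apply short_of_lt with y; [lra | auto]).
Qed.

Lemma ms_lt_inv k x y :
  0 <= y -> short_le k x -> ms k x < ms k y -> x < y.
Proof.
intros Hy Hx H; destruct (Rlt_or_le x y) as [|[Hlt | <-]]; auto; try lra.
assert (ms k y < ms k x) by (apply ms_incr; auto); lra.
Qed.

Lemma ms_le_inv k x y :
  0 <= y -> short_le k x -> ms k x <= ms k y -> x <= y.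
Proof.
intros Hy Hx H; destruct (Rle_or_lt x y) as [|Hlt]; auto.
assert (ms k y < ms k x) by (apply ms_incr; auto); lra.
Qed.

Lemma ms_inj k x y : 0 <= x -> 0 <= y -> short_le k x -> short_le k y ->
  ms k x = ms k y -> x = y.
Proof. intros; apply Rle_antisym; apply (ms_le_inv k); auto; lra. Qed.

Lemma ms_nonneg k x : 0 <= ms k x.
Proof. unfold ms; assert (H := pow2_ge_0 (sn k (x / 2))); lra. Qed.

(** * Comparison angles *)

(** The law of cosines: in a triangle with sides [x], [y], [d] this is
    [sn k x * sn k y] times the cosine of the angle between [x] and [y].  It is
    [(cs k d - cs k x * cs k y) / k], in a form that makes sense at [k = 0]. *)
Definition hinge (k x y d : R) : R := ms k x + ms k y - ms k d - k * (ms k x * ms k y).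

(** Half-angle formula: the product of the last two factors is
    [sn k x * sn k y] times the squared sine of the half angle.  Being a product
    of values of [sn], it depends on [k] in a tractable way. *)
Lemma hinge_sub k x y d : hinge k x y d =
  sn k x * sn k y - 2 * (sn k ((y + d - x) / 2) * sn k ((x + d - y) / 2)).
Proof.
unfold hinge; assert (H := ms_minus k d (x - y)); rewrite ms_diff in H.
replace ((d + (x - y)) / 2) with ((x + d - y) / 2) in H by field.
replace ((d - (x - y)) / 2) with ((y + d - x) / 2) in H by field; lra.
Qed.

(** The same for the squared cosine of the half angle. *)
Lemma hinge_add k x y d : hinge k x y d =
  - (sn k x * sn k y) + 2 * (sn k ((x + y + d) / 2) * sn k ((x + y - d) / 2)).
Proof.
unfold hinge; assert (H := ms_minus k (x + y) d).
replace (x + y) with (x - - y) in H at 1 by ring.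
rewrite ms_diff, ms_opp, sn_opp in H; lra.
Qed.

Lemma pos_of_derive_pos (f f' : R -> R) (t : R) :
  (forall x, is_derive f x (f' x)) -> f 0 = 0 -> 0 < t ->
  (forall x, 0 < x < t -> 0 < f' x) -> 0 < f t.
Proof.
intros Hf H0 Ht Hpos.
destruct (MVT_cor2 f f' 0 t Ht) as [c [E Hc]].
{ intros x _; apply is_derive_Reals; auto. }
rewrite H0 in E; assert (0 < f' c * (t - 0)); [| lra].
apply Rmult_lt_0_compat; [auto | lra].
Qed.

(** Sturm comparison: the Wronskian of [sn k1] and [sn k2] vanishes at [0] and
    has derivative [(k2 - k1) * (sn k1 t * sn k2 t)]. *)
Lemma sn_wronskian k1 k2 t : k1 < k2 -> 0 < t -> short k2 t ->
  0 < sn k2 t * cs k1 t - cs k2 t * sn k1 t.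
Proof.
intros Hk Ht Hw.
apply (pos_of_derive_pos (fun t => sn k2 t * cs k1 t - cs k2 t * sn k1 t)
   (fun t => (k2 - k1) * (sn k1 t * sn k2 t))); auto.
- intros x; evar_last.
  { apply (is_derive_minus (V := R_NormedModule));
    apply (is_derive_mult (K := R_AbsRing));
    [apply is_derive_sn | apply is_derive_cs | | apply is_derive_cs
    | apply is_derive_sn | ]; intros; apply Rmult_comm. }
  unfold minus, plus, opp, mult; simpl; ring.
- rewrite !sn_0; ring.
- intros x Hx; apply Rmult_lt_0_compat; [lra |].
  assert (short k2 x) by (apply short_of with t; [lra | auto]).
  apply Rmult_lt_0_compat; apply sn_pos; auto; try lra.
  apply short_curvature with k2; auto; lra.
Qed.

(** By the sign of the Wronskian, [sn k2 / sn k1] decreases on the interval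
    where both are positive. *)
Lemma sn_ratio_lt k1 k2 u v : k1 < k2 -> 0 < u < v -> short k2 v ->
  sn k1 u / sn k1 v < sn k2 u / sn k2 v.
Proof.
intros Hk Huv Hw.
assert (Hpos : forall x, 0 < x <= v -> 0 < sn k1 x /\ 0 < sn k2 x).
{ intros x Hx.
  assert (short k2 x) by (apply short_of with v; [lra | auto]).
  split; apply sn_pos; auto; try lra.
  apply short_curvature with k2; auto; lra. }
assert (Hdec : sn k2 v / sn k1 v < sn k2 u / sn k1 u).
{ destruct (MVT_cor2 (fun t => sn k2 t / sn k1 t) (fun t =>
    - (sn k2 t * cs k1 t - cs k2 t * sn k1 t) / sn k1 t ^ 2) u v) as [c [E Hc]].
  - lra.
  - intros x Hx; apply is_derive_Reals.
    assert (Hp := Hpos x ltac:(lra)).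
    evar_last.
    { apply is_derive_div; [apply is_derive_sn | apply is_derive_sn | lra]. }
    simpl; field; lra.
  - assert (Hp := Hpos c ltac:(lra)).
    assert (Hn : 0 < sn k2 c * cs k1 c - cs k2 c * sn k1 c).
    { apply sn_wronskian; try lra; apply short_of with v; [lra | auto]. }
    assert (0 < (sn k2 c * cs k1 c - cs k2 c * sn k1 c) / sn k1 c ^ 2 * (v - u)).
    { apply Rmult_lt_0_compat; [| lra]; apply Rdiv_lt_0_compat; auto.
      apply pow_lt; lra. }
    unfold Rdiv in *; rewrite <- Ropp_mult_distr_l in E; lra. }
destruct (Hpos u) as [A1 A2]; [lra |]; destruct (Hpos v) as [B1 B2]; [lra |].
apply (Rmult_lt_reg_r (sn k1 v * sn k2 v)); [apply Rmult_lt_0_compat; auto |].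
apply (Rmult_lt_compat_r (sn k1 v * sn k1 u)) in Hdec;
  [| apply Rmult_lt_0_compat; auto].
field_simplify in Hdec; try lra; field_simplify; lra.
Qed.

Definition angle_cos (k x y d : R) : R := hinge k x y d / (sn k x * sn k y).

Lemma sn_ratio_le k1 k2 u v : k1 < k2 -> 0 <= u <= v -> 0 < v -> short k2 v ->
  0 <= sn k1 u / sn k1 v <= sn k2 u / sn k2 v /\
  (0 < u -> 0 < sn k1 u / sn k1 v) /\
  (0 < u -> sn k1 u / sn k1 v = sn k2 u / sn k2 v -> u = v).
Proof.
intros Hk Huv Hv Hw.
assert (Hw1 : short k1 v) by (apply short_curvature with k2; auto; lra).
assert (P1 := sn_pos k1 v Hv Hw1); assert (P2 := sn_pos k2 v Hv Hw).
destruct (Req_dec u 0) as [-> | Hu].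
{ rewrite !sn_0; unfold Rdiv; rewrite !Rmult_0_l; repeat split; lra. }
assert (Pu : 0 < sn k1 u).
{ apply sn_pos; [lra |]; apply short_of with v; auto; lra. }
assert (Hp : 0 < sn k1 u / sn k1 v) by (apply Rdiv_lt_0_compat; auto).
destruct (Req_dec u v) as [-> | Huv'].
{ rewrite !Rdiv_diag by lra; repeat split; lra. }
assert (H := sn_ratio_lt k1 k2 u v Hk ltac:(lra) Hw).
repeat split; lra.
Qed.

Definition flat_triple (x y d : R) : Prop := d = x + y \/ x = y + d \/ y = x + d.

(** Comparison angles grow with the curvature.  With [p = (y + d - x) / 2] and
    [q = (x + d - y) / 2], the squared sine of the half angle is the product of
    the ratios [sn k p / sn k y] and [sn k q / sn k x], both of which increase
    with [k], strictly unless the triple is degenerate. *)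
Lemma angle_cos_mono k1 k2 x y d :
  k1 < k2 -> 0 < x -> 0 < y -> short k2 x -> short k2 y ->
  d <= x + y -> x <= y + d -> y <= x + d ->
  angle_cos k2 x y d <= angle_cos k1 x y d /\
  (angle_cos k2 x y d = angle_cos k1 x y d -> flat_triple x y d).
Proof.
intros Hk Hx Hy Wx Wy H1 H2 H3.
assert (V1x : short k1 x) by (apply short_curvature with k2; auto; lra).
assert (V1y : short k1 y) by (apply short_curvature with k2; auto; lra).
assert (Px1 := sn_pos k1 x Hx V1x); assert (Px2 := sn_pos k2 x Hx Wx).
assert (Py1 := sn_pos k1 y Hy V1y); assert (Py2 := sn_pos k2 y Hy Wy).
set (p := (y + d - x) / 2); set (q := (x + d - y) / 2).
assert (E : forall k, 0 < sn k x -> 0 < sn k y -> angle_cos k x y d =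
   1 - 2 * ((sn k p / sn k y) * (sn k q / sn k x))).
{ intros k Kx Ky; unfold angle_cos; rewrite hinge_sub; fold p q; field; lra. }
rewrite !E by auto.
destruct (sn_ratio_le k1 k2 p y Hk) as [A1 [A2 A3]]; auto;
  try (unfold p; split; lra).
destruct (sn_ratio_le k1 k2 q x Hk) as [B1 [B2 B3]]; auto;
  try (unfold q; split; lra).
set (p1 := sn k1 p / sn k1 y) in *; set (p2 := sn k2 p / sn k2 y) in *.
set (q1 := sn k1 q / sn k1 x) in *; set (q2 := sn k2 q / sn k2 x) in *.
split; [assert (p1 * q1 <= p2 * q2) by (apply Rmult_le_compat; lra); lra |].
intros Heq; assert (Epq : p2 * q2 = p1 * q1) by lra.
unfold flat_triple.
destruct (Req_dec p 0) as [Ep | Hp]; [right; left; unfold p in Ep; lra |].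
destruct (Req_dec q 0) as [Eq | Hq]; [right; right; unfold q in Eq; lra |].
assert (0 <= p /\ 0 <= q) by (unfold p, q; lra).
specialize (A2 ltac:(lra)); specialize (B2 ltac:(lra)).
left; assert (p1 = p2).
{ apply Rle_antisym; [lra |]; apply Rmult_le_reg_r with q1; auto.
  assert (p2 * q1 <= p2 * q2) by (apply Rmult_le_compat_l; lra); lra. }
specialize (A3 ltac:(lra) ltac:(lra)); unfold p in A3; lra.
Qed.

(** * Model surfaces in barycentric form *)

(** [ms k] of the distance, as a polynomial in the coordinates. *)
Definition chord (k : R) (P Q : vec3) : R :=
  if Rlt_dec 0 k then (1 - dot P Q) / k
  else if Rlt_dec k 0 then (1 - lorentz P Q) / k
  else ((vx P - vx Q) ^ 2 + (vy P - vy Q) ^ 2) / 2.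

Lemma ms_cs k t : k <> 0 -> ms k t = (1 - cs k t) / k.
Proof. intros H; rewrite cs_ms; field; auto. Qed.

(** Reversed Cauchy inequality.  The difference of the two sides is
    [a ^ 2 + b ^ 2 - c ^ 2] for the coordinates of a cross product that is
    orthogonal to the timelike vector [P], hence spacelike. *)
Lemma lorentz_cauchy P Q : 0 < vz P -> lorentz P P = 1 ->
  lorentz Q Q <= lorentz P Q ^ 2.
Proof.
intros Hz HP; destruct P as [x y z], Q as [x' y' z'].
unfold lorentz in *; simpl in *.
set (a := x * z' - z * x'); set (b := y * z' - z * y').
set (c := x * y' - y * x').
assert (E : (z * z' - x * x' - y * y') ^ 2 -
   (z * z - x * x - y * y) * (z' * z' - x' * x' - y' * y') =
   a ^ 2 + b ^ 2 - c ^ 2) by (unfold a, b, c; ring).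
assert (Hc : z ^ 2 * c ^ 2 <= z ^ 2 * (a ^ 2 + b ^ 2)).
{ replace (z ^ 2 * c ^ 2) with ((y * a - x * b) ^ 2) by (unfold a, b, c; ring).
  replace (z ^ 2) with (1 + x ^ 2 + y ^ 2) by lra.
  assert (0 <= (x * a + y * b) ^ 2 + a ^ 2 + b ^ 2); [| lra].
  assert (H1 := pow2_ge_0 (x * a + y * b)); assert (H2 := pow2_ge_0 a).
  assert (H3 := pow2_ge_0 b); lra. }
apply Rmult_le_reg_l in Hc; [| apply pow_lt; auto].
rewrite HP in E; lra.
Qed.

Lemma lorentz_ge_1 k P Q : k < 0 -> on_model k P -> on_model k Q ->
  1 <= lorentz P Q.
Proof.
intros Hk [_ [_ HP]] [_ [_ HQ]].
destruct (HP Hk) as [zP LP]; destruct (HQ Hk) as [zQ LQ].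
assert (H := lorentz_cauchy P Q zP LP); rewrite LQ in H.
assert (Hpos : 0 < lorentz P Q); [| nra].
clear H HP HQ; destruct P as [x y z], Q as [x' y' z'].
unfold lorentz in *; simpl in *.
assert (H : (x * x' + y * y') ^ 2 < (z * z') ^ 2).
{ replace ((z * z') ^ 2) with ((1 + x * x + y * y) * (1 + x' * x' + y' * y'))
    by (replace (1 + x * x + y * y) with (z * z) by lra;
        replace (1 + x' * x' + y' * y') with (z' * z') by lra; ring).
  assert (A := pow2_ge_0 (x * y' - y * x')).
  assert (B := Rle_0_sqr x); assert (C := Rle_0_sqr y).
  assert (D := Rle_0_sqr x'); assert (E := Rle_0_sqr y').
  unfold Rsqr in *; lra. }
assert (0 < z * z') by (apply Rmult_lt_0_compat; auto).
assert (x * x' + y * y' < z * z'); [| lra].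
apply Rnot_le_lt; intros Hle.
assert ((z * z') ^ 2 <= (x * x' + y * y') ^ 2) by (apply pow_incr; lra); lra.
Qed.

Lemma cosh_arcosh t : 1 <= t -> cosh (arcosh t) = t.
Proof.
intros Ht; unfold cosh, arcosh.
assert (Hs : sqrt (t ^ 2 - 1) * sqrt (t ^ 2 - 1) = t ^ 2 - 1)
  by (apply sqrt_sqrt; nra).
assert (H0 := sqrt_pos (t ^ 2 - 1)); set (s := sqrt _) in *.
assert (0 < t + s) by lra.
rewrite exp_Ropp, exp_ln by auto.
apply (Rmult_eq_reg_r (2 * (t + s))); [| lra]; field_simplify; [| lra].
replace (s ^ 2) with (t ^ 2 - 1) by lra; ring.
Qed.

Lemma arcosh_nonneg t : 1 <= t -> 0 <= arcosh t.
Proof.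
intros Ht; unfold arcosh; rewrite <- ln_1; apply ln_le; [lra |].
assert (H0 := sqrt_pos (t ^ 2 - 1)); lra.
Qed.

Lemma dot_cauchy P Q : dot P P = 1 -> dot Q Q = 1 -> -1 <= dot P Q <= 1.
Proof.
destruct P as [x y z], Q as [x' y' z']; unfold dot; simpl; intros HP HQ.
assert (A := pow2_ge_0 (x + x')); assert (B := pow2_ge_0 (y + y')).
assert (C := pow2_ge_0 (z + z')); assert (D := pow2_ge_0 (x - x')).
assert (E := pow2_ge_0 (y - y')); assert (F := pow2_ge_0 (z - z')); lra.
Qed.

Lemma model_dist_spec k P Q : on_model k P -> on_model k Q ->
  0 <= model_dist k P Q /\ short_le k (model_dist k P Q) /\
  ms k (model_dist k P Q) = chord k P Q.
Proof.
intros HP HQ; unfold model_dist, chord, short_le.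
curvature_cases k; try sqrt_facts k.
- destruct HP as [_ [HP _]], HQ as [_ [HQ _]].
  assert (D := dot_cauchy P Q (HP Hk) (HQ Hk)).
  assert (B := acos_bound (dot P Q)).
  assert (E : acos (dot P Q) / sqrt k * sqrt k = acos (dot P Q)) by (field; lra).
  split; [apply Rdiv_le_0_compat; lra |]; split; [intros _; lra |].
  rewrite ms_cs by lra; unfold cs; destruct (Rlt_dec 0 k) as [_|]; [| lra].
  rewrite E, cos_acos by auto; reflexivity.
- assert (L := lorentz_ge_1 k P Q Hk' HP HQ).
  assert (B := arcosh_nonneg _ L).
  assert (E : arcosh (lorentz P Q) / sqrt (- k) * sqrt (- k) =
     arcosh (lorentz P Q)) by (field; lra).
  split; [apply Rdiv_le_0_compat; lra |]; split; [intros; lra |].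
  rewrite ms_cs by lra; unfold cs; destruct (Rlt_dec 0 k) as [|_]; [lra |].
  destruct (Rlt_dec k 0) as [_|]; [| lra].
  rewrite E, cosh_arcosh by auto; reflexivity.
- split; [apply sqrt_pos |]; split; [intros; lra |].
  unfold ms, sn; destruct (Rlt_dec 0 0) as [|_]; [lra |].
  replace (2 * (_ / 2) ^ 2) with
    ((sqrt ((vx P - vx Q) ^ 2 + (vy P - vy Q) ^ 2) *
      sqrt ((vx P - vx Q) ^ 2 + (vy P - vy Q) ^ 2)) / 2) by field.
  rewrite sqrt_sqrt; auto.
  assert (A := pow2_ge_0 (vx P - vx Q)); assert (B := pow2_ge_0 (vy P - vy Q)).
  lra.
Qed.

Lemma chord_sym k P Q : chord k P Q = chord k Q P.
Proof.
unfold chord, dot, lorentz.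
destruct (Rlt_dec 0 k); [f_equal; ring |].
destruct (Rlt_dec k 0); [f_equal; ring |].
f_equal; ring.
Qed.

Definition qform (a11 a22 a33 a12 a13 a23 x1 x2 x3 : R) : R :=
  a11 * x1 ^ 2 + a22 * x2 ^ 2 + a33 * x3 ^ 2 +
  2 * (a12 * (x1 * x2) + a13 * (x1 * x3) + a23 * (x2 * x3)).

Definition comb (u v w : R) (A B C : vec3) : vec3 :=
  Vec3 (u * vx A + v * vx B + w * vx C)
       (u * vy A + v * vy B + w * vy C)
       (u * vz A + v * vz B + w * vz C).

(** Half of the sum of [u_i * u_j * h_ij]: when [h_ij] are chords between
    vertices, the squared norm of the combination with weights [u, v, w] is
    [(u + v + w) ^ 2 - 2 * k * pairs]. *)
Definition pairs (h12 h13 h23 u v w : R) : R :=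
  u * v * h12 + u * w * h13 + v * w * h23.

(** Seen from [P], the numbers [hinge] are, up to a positive factor, the inner
    products of the initial velocities of the geodesics to [A], [B], [C]; the
    tangent plane at [P] being Euclidean, their quadratic form is nonnegative. *)
Lemma hinge_form_nonneg k P A B C h1 h2 h3 h12 h13 h23 x y z :
  on_model k P -> on_model k A -> on_model k B -> on_model k C ->
  chord k P A = h1 -> chord k P B = h2 -> chord k P C = h3 ->
  chord k A B = h12 -> chord k A C = h13 -> chord k B C = h23 ->
  0 <= qform (2 * h1 - k * h1 ^ 2) (2 * h2 - k * h2 ^ 2) (2 * h3 - k * h3 ^ 2)
    (h1 + h2 - h12 - k * (h1 * h2)) (h1 + h3 - h13 - k * (h1 * h3))
    (h2 + h3 - h23 - k * (h2 * h3)) x y z.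
Proof.
intros [P0 [P1 P2]] [A0 [A1 A2]] [B0 [B1 B2]] [C0 [C1 C2]].
intros <- <- <- <- <- <-; unfold chord, qform; curvature_cases k.
- specialize (P1 Hk); specialize (A1 Hk); specialize (B1 Hk); specialize (C1 Hk).
  match goal with |- 0 <= ?e => replace e with
   ((x ^ 2 * (dot A A - dot P A ^ 2) + y ^ 2 * (dot B B - dot P B ^ 2) +
     z ^ 2 * (dot C C - dot P C ^ 2) +
     2 * (x * y * (dot A B - dot P A * dot P B) +
          x * z * (dot A C - dot P A * dot P C) +
          y * z * (dot B C - dot P B * dot P C))) / k) end.
  2: { rewrite A1, B1, C1; field; lra. }
  apply Rdiv_le_0_compat; auto.
  set (W := comb x y z A B C).
  match goal with |- 0 <= ?e => replace e with (1 * dot W W - dot P W ^ 2)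
    by (unfold W, comb, dot; simpl; ring) end.
  rewrite <- P1; clear; destruct P as [a b c], W as [a' b' c'].
  unfold dot; simpl.
  assert (H1 := pow2_ge_0 (a * b' - b * a')).
  assert (H2 := pow2_ge_0 (a * c' - c * a')).
  assert (H3 := pow2_ge_0 (b * c' - c * b')); lra.
- specialize (P2 Hk'); specialize (A2 Hk'); specialize (B2 Hk'); specialize (C2 Hk').
  match goal with |- 0 <= ?e => replace e with
   ((x ^ 2 * (lorentz P A ^ 2 - lorentz A A) +
     y ^ 2 * (lorentz P B ^ 2 - lorentz B B) +
     z ^ 2 * (lorentz P C ^ 2 - lorentz C C) +
     2 * (x * y * (lorentz P A * lorentz P B - lorentz A B) +
          x * z * (lorentz P A * lorentz P C - lorentz A C) +
          y * z * (lorentz P B * lorentz P C - lorentz B C))) / (- k)) end.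
  2: { destruct A2 as [_ ->], B2 as [_ ->], C2 as [_ ->]; field; lra. }
  apply Rdiv_le_0_compat; [| lra].
  set (W := comb x y z A B C).
  match goal with |- 0 <= ?e => replace e with (lorentz P W ^ 2 - lorentz W W)
    by (unfold W, comb, lorentz; simpl; ring) end.
  assert (H := lorentz_cauchy P W (proj1 P2) (proj2 P2)); lra.
- set (X := x * (vx A - vx P) + y * (vx B - vx P) + z * (vx C - vx P)).
  set (Y := x * (vy A - vy P) + y * (vy B - vy P) + z * (vy C - vy P)).
  assert (H1 := pow2_ge_0 X); assert (H2 := pow2_ge_0 Y).
  match goal with |- 0 <= ?e => replace e with (X ^ 2 + Y ^ 2)
    by (unfold X, Y; field) end.
  lra.
Qed.

Lemma comb_on_model k A B C u v w h12 h13 h23 :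
  on_model k A -> on_model k B -> on_model k C ->
  chord k A B = h12 -> chord k A C = h13 -> chord k B C = h23 ->
  0 <= u -> 0 <= v -> 0 <= w ->
  (on_model k (comb u v w A B C) <->
   0 < u + v + w /\ (u + v + w) ^ 2 - 2 * k * pairs h12 h13 h23 u v w = 1).
Proof.
intros [A0 [A1 A2]] [B0 [B1 B2]] [C0 [C1 C2]] <- <- <- Hu Hv Hw.
unfold on_model, chord, pairs.
curvature_cases k.
- specialize (A1 Hk); specialize (B1 Hk); specialize (C1 Hk).
  replace ((u + v + w) ^ 2 - _) with
    (dot (comb u v w A B C) (comb u v w A B C)).
  2: { transitivity (u ^ 2 * dot A A + v ^ 2 * dot B B + w ^ 2 * dot C C +
         2 * (u * v * dot A B + u * w * dot A C + v * w * dot B C));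
       [unfold comb, dot; simpl; ring | rewrite A1, B1, C1; field; lra]. }
  split.
  + intros [_ [H _]]; specialize (H Hk); split; auto.
    destruct (Req_dec (u + v + w) 0) as [E|]; [| lra].
    assert (u = 0) by lra; assert (v = 0) by lra; assert (w = 0) by lra.
    subst; unfold comb, dot in H; simpl in H; lra.
  + intros [_ H]; repeat split; intros; lra.
- specialize (A2 Hk'); specialize (B2 Hk'); specialize (C2 Hk').
  destruct A2 as [zA A2], B2 as [zB B2], C2 as [zC C2].
  replace ((u + v + w) ^ 2 - _) with
    (lorentz (comb u v w A B C) (comb u v w A B C)).
  2: { transitivity (u ^ 2 * lorentz A A + v ^ 2 * lorentz B B +
         w ^ 2 * lorentz C C +
         2 * (u * v * lorentz A B + u * w * lorentz A C + v * w * lorentz B C));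
       [unfold comb, lorentz; simpl; ring | rewrite A2, B2, C2; field; lra]. }
  assert (0 <= u * vz A /\ 0 <= v * vz B /\ 0 <= w * vz C)
    by (repeat split; apply Rmult_le_pos; lra).
  split.
  + intros [_ [_ H1]]; specialize (H1 Hk'); destruct H1 as [H1 H2]; split; auto.
    destruct (Req_dec (u + v + w) 0) as [E|]; [| lra].
    assert (u = 0) by lra; assert (v = 0) by lra; assert (w = 0) by lra.
    subst; unfold comb in H1; simpl in H1; lra.
  + intros [H1 H2]; repeat split; intros; try lra.
    unfold comb; simpl.
    assert (0 < u \/ 0 < v \/ 0 < w) as [|[|]] by lra;
    [assert (0 < u * vz A) | assert (0 < v * vz B) | assert (0 < w * vz C)];
    try (apply Rmult_lt_0_compat; auto); lra.
- specialize (A0 eq_refl); specialize (B0 eq_refl); specialize (C0 eq_refl).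
  unfold comb; simpl; rewrite A0, B0, C0; split.
  + intros [H _]; specialize (H eq_refl).
    replace (u + v + w) with 1 by lra; split; lra.
  + intros [H1 H2]; assert (u + v + w = 1) by nra.
    repeat split; intros; lra.
Qed.

(** For [k <> 0] the last term is [(u + v + w - 1) / k]; written with [pairs] it
    keeps its meaning at [k = 0], where the formula is that of Leibniz for the
    distance to a barycentre. *)
Lemma chord_comb k A B C u v w h12 h13 h23 :
  on_model k A -> on_model k B -> on_model k C ->
  chord k A B = h12 -> chord k A C = h13 -> chord k B C = h23 ->
  0 < u + v + w ->
  (u + v + w) ^ 2 - 2 * k * pairs h12 h13 h23 u v w = 1 ->
  chord k (comb u v w A B C) A =
  v * h12 + w * h13 - 2 * pairs h12 h13 h23 u v w / (1 + (u + v + w)).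
Proof.
intros [A0 [A1 A2]] [B0 [B1 B2]] [C0 [C1 C2]] E12 E13 E23 HU HN.
assert (HM : k <> 0 -> 2 * pairs h12 h13 h23 u v w / (1 + (u + v + w)) =
   (u + v + w - 1) / k).
{ intros Hk; replace (2 * pairs h12 h13 h23 u v w) with
    (((u + v + w) ^ 2 - 1) / k) by (rewrite <- HN; field; auto).
  field; lra. }
unfold chord in *; curvature_cases k.
- specialize (A1 Hk); rewrite HM by lra; rewrite <- E12, <- E13.
  replace (dot (comb u v w A B C) A) with
    (u * dot A A + v * dot A B + w * dot A C) by (unfold comb, dot; simpl; ring).
  rewrite A1; field; lra.
- specialize (A2 Hk'); rewrite HM by lra; rewrite <- E12, <- E13.
  replace (lorentz (comb u v w A B C) A) with
    (u * lorentz A A + v * lorentz A B + w * lorentz A C)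
    by (unfold comb, lorentz; simpl; ring).
  destruct A2 as [_ ->]; field; lra.
- assert (E : u + v + w = 1) by nra; clear HM HN HU.
  rewrite E, <- E12, <- E13, <- E23; unfold pairs, comb; simpl.
  replace u with (1 - v - w) by lra; field.
Qed.

Lemma comb_swap u v w A B C : comb u v w A B C = comb v u w B A C.
Proof. unfold comb; f_equal; ring. Qed.

Lemma comb_rot u v w A B C : comb u v w A B C = comb w u v C A B.
Proof. unfold comb; f_equal; ring. Qed.

(** * Minimisation over the weights *)

Definition unit_square (x y : R) : Prop := 0 <= x <= 1 /\ 0 <= y <= 1.

(** Lower semicontinuity is all that a minimum needs, and it holds for
    distances as soon as their [ms] is continuous: the inverse of [ms] is only
    used through its monotonicity. *)
Definition lsc_on_square (F : R -> R -> R) : Prop :=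
  forall x y c, unit_square x y -> c < F x y ->
  locally_2d (fun u v => unit_square u v -> c < F u v) x y.

Lemma list_argmin {T : Type} (f : T -> R) (P : T -> Prop) (l : list T) :
  (exists t, In t l /\ P t) ->
  exists t, In t l /\ P t /\ forall u, In u l -> P u -> f t <= f u.
Proof.
induction l as [| a l IH]; intros [t [Ht Pt]]; [destruct Ht |].
destruct (classic (exists t, In t l /\ P t)) as [H | H].
- destruct (IH H) as [m [Hm [Pm Lm]]].
  destruct (classic (P a /\ f a <= f m)) as [[Pa Ha] | Hn].
  + exists a; repeat split; simpl; auto; intros u [<- | Hu] Pu; [lra |].
    specialize (Lm u Hu Pu); lra.
  + exists m; repeat split; simpl; auto; intros u [<- | Hu] Pu; auto.
    apply Rnot_lt_le; intros Hl; apply Hn; split; auto; lra.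
- destruct Ht as [<- | Ht]; [| destruct H; exists t; auto].
  exists a; repeat split; simpl; auto; intros u [<- | Hu] Pu; [lra |].
  destruct H; exists u; auto.
Qed.

(** If no point were a minimum, each would have a neighbourhood on which [F]
    exceeds one of its own values; among the finitely many such values that a
    finite cover yields, the smallest is exceeded by itself. *)
Lemma lsc_square_min F : lsc_on_square F ->
  exists x y, unit_square x y /\ forall u v, unit_square u v -> F x y <= F u v.
Proof.
intros HF; apply NNPP; intros Hno.
assert (Hbelow : forall p : R * (R * unit), exists d : posreal,
  unit_square (fst p) (fst (snd p)) -> exists u v, unit_square u v /\
  forall u' v', Rabs (u' - fst p) < d -> Rabs (v' - fst (snd p)) < d ->
    unit_square u' v' -> F u v < F u' v').
{ intros [x [y []]]; simpl.
  destruct (classic (unit_square x y)) as [Hs | Hs];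
    [| exists (mkposreal 1 Rlt_0_1); intros; contradiction].
  assert (exists u v, unit_square u v /\ F u v < F x y) as [u [v [Hu Huv]]].
  { apply NNPP; intros Hn; apply Hno; exists x, y; split; auto.
    intros u v Hu; apply Rnot_lt_le; intros Hl; apply Hn; exists u, v; auto. }
  destruct (HF x y (F u v) Hs Huv) as [d Hd].
  exists d; intros _; exists u, v; auto. }
set (delta p := proj1_sig (constructive_indefinite_description _ (Hbelow p))).
assert (Hdelta : forall p : R * (R * unit),
  unit_square (fst p) (fst (snd p)) -> exists u v, unit_square u v /\
  forall u' v', Rabs (u' - fst p) < delta p ->
    Rabs (v' - fst (snd p)) < delta p -> unit_square u' v' -> F u v < F u' v').
{ intros p; unfold delta; destruct constructive_indefinite_description; auto. }
apply (compactness_list 2 (0, (0, tt)) (1, (1, tt)) delta); intros [l Hl].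
assert (Hbox : forall x y, unit_square x y ->
  exists p, In p l /\ unit_square (fst p) (fst (snd p)) /\
    Rabs (x - fst p) < delta p /\ Rabs (y - fst (snd p)) < delta p).
{ intros x y [Hx Hy]; destruct (Hl (x, (y, tt))) as [[s [t []]] [H1 [H2 H3]]].
  { simpl; tauto. }
  simpl in H2, H3; exists (s, (t, tt)); unfold unit_square; simpl; tauto. }
assert (Hval : forall p : R * (R * unit), exists r,
  unit_square (fst p) (fst (snd p)) ->
  (exists u v, unit_square u v /\ F u v = r) /\
  forall u' v', Rabs (u' - fst p) < delta p ->
    Rabs (v' - fst (snd p)) < delta p -> unit_square u' v' -> r < F u' v').
{ intros p; destruct (classic (unit_square (fst p) (fst (snd p)))) as [Hs | Hs].
  - destruct (Hdelta p Hs) as [u [v [Hu Hv]]].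
    exists (F u v); intros _; split; [exists u, v |]; auto.
  - exists 0; tauto. }
set (val p := proj1_sig (constructive_indefinite_description _ (Hval p))).
assert (Hv : forall p, unit_square (fst p) (fst (snd p)) ->
  (exists u v, unit_square u v /\ F u v = val p) /\
  forall u' v', Rabs (u' - fst p) < delta p ->
    Rabs (v' - fst (snd p)) < delta p -> unit_square u' v' -> val p < F u' v').
{ intros p; unfold val; destruct constructive_indefinite_description; auto. }
destruct (list_argmin val (fun p => unit_square (fst p) (fst (snd p))) l)
  as [p [_ [Sp Mp]]].
{ destruct (Hbox 0 0) as [p Hp]; [unfold unit_square; lra |].
  exists p; tauto. }
destruct (Hv p Sp) as [[u [v [Su Eu]]] _].
destruct (Hbox u v Su) as [q [Iq [Sq [D1 D2]]]].
assert (A := proj2 (Hv q Sq) u v D1 D2 Su).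
assert (B := Mp q Iq Sq); lra.
Qed.

Lemma lsc_plus F G : lsc_on_square F -> lsc_on_square G ->
  lsc_on_square (fun x y => F x y + G x y).
Proof.
intros HF HG x y c Hs Hc; set (e := (F x y + G x y - c) / 2).
apply (locally_2d_impl (fun u v => unit_square u v -> F x y - e < F u v)).
2: { apply HF; auto; unfold e; lra. }
apply (locally_2d_impl (fun u v => unit_square u v -> G x y - e < G u v)).
2: { apply HG; auto; unfold e; lra. }
apply locally_2d_forall; intros u v A B C.
specialize (A C); specialize (B C); unfold e in *; lra.
Qed.

Lemma continuity_2d_gt f x y c : continuity_2d_pt f x y -> c < f x y ->
  locally_2d (fun u v => c < f u v) x y.
Proof.
intros Hf Hc.
apply (locally_2d_impl _ _ _ _) with (2 := Hf (mkposreal _ (proj2 (Rlt_0_minus _ _) Hc))).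
apply locally_2d_forall; intros u v; simpl; intros H.
apply Rabs_lt_between in H; lra.
Qed.

Lemma lsc_of_ms k (X g : R -> R -> R) :
  (forall x y, unit_square x y ->
     0 <= X x y /\ short_le k (X x y) /\ ms k (X x y) = g x y) ->
  (forall x y, unit_square x y -> continuity_2d_pt g x y) -> lsc_on_square X.
Proof.
intros HX Hg x y c Hs Hc.
destruct (HX x y Hs) as [A [B C]].
destruct (Rlt_or_le c 0) as [Hn | Hp].
{ apply locally_2d_forall; intros u v Hu; destruct (HX u v Hu); lra. }
assert (Hcg : ms k c < g x y) by (rewrite <- C; apply ms_incr; auto).
apply (locally_2d_impl _ _ _ _) with (2 := continuity_2d_gt g x y _ (Hg x y Hs) Hcg).
apply locally_2d_forall; intros u v Hgt Hu.
destruct (HX u v Hu) as [A' [B' C']].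
apply (ms_lt_inv k); auto; [| lra].
apply short_le_of with (X x y); [lra | auto].
Qed.

Definition simplex (u v w : R) : Prop := 0 <= u /\ 0 <= v /\ 0 <= w /\ u + v + w = 1.

(** The square [0 <= x, y <= 1] is mapped onto the simplex, so that
    compactness of the square suffices. *)
Definition square_u (x y : R) : R := 1 - x.
Definition square_v (x y : R) : R := x * (1 - y).
Definition square_w (x y : R) : R := x * y.

Lemma square_simplex x y : unit_square x y -> simplex (square_u x y) (square_v x y) (square_w x y).
Proof.
intros [Hx Hy]; unfold simplex, square_u, square_v, square_w.
assert (0 <= x * (1 - y)) by (apply Rmult_le_pos; lra).
assert (0 <= x * y) by (apply Rmult_le_pos; lra).
repeat split; lra.
Qed.

Lemma simplex_square u v w : simplex u v w -> exists x y, unit_square x y /\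
  square_u x y = u /\ square_v x y = v /\ square_w x y = w.
Proof.
intros [Hu [Hv [Hw E]]]; unfold unit_square, square_u, square_v, square_w.
destruct (Req_dec (v + w) 0) as [H | H].
- exists 0, 0; repeat split; lra.
- exists (v + w), (w / (v + w)); repeat split; try lra.
  + apply Rdiv_le_0_compat; lra.
  + apply Rle_div_l; lra.
  + field; lra.
  + field; lra.
Qed.

(** The norm of a combination whose weights have sum [1]; dividing the weights
    by it puts the combination on the surface. *)
Definition spread (k h12 h13 h23 u v w : R) : R :=
  sqrt (1 - 2 * k * pairs h12 h13 h23 u v w).

Definition spread_pos (k h12 h13 h23 : R) : Prop :=
  forall u v w, simplex u v w -> 0 < 1 - 2 * k * pairs h12 h13 h23 u v w.

Ltac continuity_2d :=
  repeat first
  [ apply continuity_2d_pt_minus | apply continuity_2d_pt_plus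
  | apply continuity_2d_pt_mult | apply continuity_2d_pt_opp | apply continuity_2d_pt_const
  | apply continuity_2d_pt_id1 | apply continuity_2d_pt_id2 ].

Lemma continuity_pairs h12 h13 h23 x y :
  continuity_2d_pt (fun x y => pairs h12 h13 h23 (square_u x y) (square_v x y) (square_w x y)) x y.
Proof. unfold pairs, square_u, square_v, square_w; continuity_2d. Qed.

Lemma continuity_spread k h12 h13 h23 x y : spread_pos k h12 h13 h23 ->
  unit_square x y ->
  continuity_2d_pt (fun x y => spread k h12 h13 h23 (square_u x y) (square_v x y) (square_w x y)) x y.
Proof.
intros Hp Hs; unfold spread.
apply (continuity_1d_2d_pt_comp sqrt).
- apply continuity_pt_sqrt; left; apply Hp, square_simplex; auto.
- apply continuity_2d_pt_minus; [continuity_2d |].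
  apply continuity_2d_pt_mult; [continuity_2d | apply continuity_pairs].
Qed.

Lemma spread_spec k h12 h13 h23 u v w : spread_pos k h12 h13 h23 ->
  simplex u v w -> 0 < spread k h12 h13 h23 u v w /\
  spread k h12 h13 h23 u v w ^ 2 = 1 - 2 * k * pairs h12 h13 h23 u v w.
Proof.
intros Hp Hs; specialize (Hp u v w Hs); unfold spread; split.
- apply sqrt_lt_R0; auto.
- apply pow2_sqrt; lra.
Qed.

(** The point of the surface on the ray of the weights [u, v, w]. *)
Definition bary (k h12 h13 h23 u v w : R) (A B C : vec3) : vec3 :=
  let N := spread k h12 h13 h23 u v w in comb (u / N) (v / N) (w / N) A B C.

(** The chord from the vertex whose weighted sum of chords to the others is [s]
    to the point [bary]. *)
Definition bary_chord (k h12 h13 h23 s u v w : R) : R :=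
  let N := spread k h12 h13 h23 u v w in
  (s - 2 * pairs h12 h13 h23 u v w / (1 + N)) / N.

Lemma bary_spec k A B C h12 h13 h23 u v w :
  on_model k A -> on_model k B -> on_model k C ->
  chord k A B = h12 -> chord k A C = h13 -> chord k B C = h23 ->
  spread_pos k h12 h13 h23 -> simplex u v w ->
  let P := bary k h12 h13 h23 u v w A B C in
  on_model k P /\ in_cone A B C P /\
  chord k P A = bary_chord k h12 h13 h23 (v * h12 + w * h13) u v w /\
  chord k P B = bary_chord k h12 h13 h23 (u * h12 + w * h23) u v w /\
  chord k P C = bary_chord k h12 h13 h23 (u * h13 + v * h23) u v w.
Proof.
intros HA HB HC E12 E13 E23 Hp Hs P; unfold P, bary, bary_chord.
destruct (spread_spec k h12 h13 h23 u v w Hp Hs) as [HN EN].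
destruct Hs as [Hu [Hv [Hw E]]].
set (N := spread _ _ _ _ _ _ _) in *.
assert (Hu' : 0 <= u / N) by (apply Rdiv_le_0_compat; auto).
assert (Hv' : 0 <= v / N) by (apply Rdiv_le_0_compat; auto).
assert (Hw' : 0 <= w / N) by (apply Rdiv_le_0_compat; auto).
assert (ES : u / N + v / N + w / N = 1 / N) by (rewrite <- E; field; lra).
assert (HS : 0 < 1 / N) by (apply Rdiv_lt_0_compat; lra).
assert (EP : pairs h12 h13 h23 (u / N) (v / N) (w / N) =
  pairs h12 h13 h23 u v w / N ^ 2) by (unfold pairs; field; lra).
assert (Hnorm : (u / N + v / N + w / N) ^ 2 -
  2 * k * pairs h12 h13 h23 (u / N) (v / N) (w / N) = 1).
{ rewrite ES, EP.
  replace (2 * k * (pairs h12 h13 h23 u v w / N ^ 2)) with ((1 - N ^ 2) / N ^ 2)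
    by (rewrite EN; field; rewrite <- EN; apply pow_nonzero; lra).
  field; lra. }
split; [| split; [| split; [| split]]].
- apply (comb_on_model k A B C _ _ _ h12 h13 h23); auto; split; auto; lra.
- exists (u / N), (v / N), (w / N); repeat split; auto.
- rewrite (chord_comb k A B C _ _ _ h12 h13 h23); auto; try lra.
  rewrite ES, EP; field; repeat split; lra.
- rewrite comb_swap.
  assert (EP' : pairs h12 h23 h13 (v / N) (u / N) (w / N) =
    pairs h12 h13 h23 (u / N) (v / N) (w / N)) by (unfold pairs; ring).
  rewrite (chord_comb k B A C _ _ _ h12 h23 h13); auto; try lra.
  + rewrite EP', EP.
    replace (v / N + u / N + w / N) with (1 / N) by lra.
    field; repeat split; lra.
  + now rewrite chord_sym.
  + rewrite EP'; lra.
- rewrite comb_rot.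
  assert (EP' : pairs h13 h23 h12 (w / N) (u / N) (v / N) =
    pairs h12 h13 h23 (u / N) (v / N) (w / N)) by (unfold pairs; ring).
  rewrite (chord_comb k C A B _ _ _ h13 h23 h12); auto; try lra.
  + rewrite EP', EP.
    replace (w / N + u / N + v / N) with (1 / N) by lra.
    field; repeat split; lra.
  + now rewrite chord_sym.
  + now rewrite chord_sym.
  + rewrite EP'; lra.
Qed.

Lemma bary_surjective k A B C h12 h13 h23 P :
  on_model k A -> on_model k B -> on_model k C ->
  chord k A B = h12 -> chord k A C = h13 -> chord k B C = h23 ->
  on_model k P -> in_cone A B C P ->
  exists u v w, simplex u v w /\ P = bary k h12 h13 h23 u v w A B C.
Proof.
intros HA HB HC E12 E13 E23 HP [u [v [w [Hu [Hv [Hw E]]]]]].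
change (P = comb u v w A B C) in E; rewrite E in HP.
apply (comb_on_model k A B C u v w h12 h13 h23) in HP; auto.
destruct HP as [HS HN]; set (U := u + v + w) in *.
exists (u / U), (v / U), (w / U).
split; [repeat split; try (apply Rdiv_le_0_compat; auto); unfold U; field; auto |].
{ unfold U in HS; lra. }
assert (EN : spread k h12 h13 h23 (u / U) (v / U) (w / U) = / U).
{ unfold spread; apply sqrt_lem_1.
  - replace (pairs h12 h13 h23 (u / U) (v / U) (w / U)) with
      (pairs h12 h13 h23 u v w / U ^ 2) by (unfold pairs; field; lra).
    replace (1 - _) with ((U ^ 2 - 2 * k * pairs h12 h13 h23 u v w) / U ^ 2)
      by (field; lra).
    rewrite HN; apply Rdiv_le_0_compat; [lra | apply pow_lt; lra].
  - left; apply Rinv_0_lt_compat; auto.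
  - replace (pairs h12 h13 h23 (u / U) (v / U) (w / U)) with
      (pairs h12 h13 h23 u v w / U ^ 2) by (unfold pairs; field; lra).
    replace (1 - _) with ((U ^ 2 - 2 * k * pairs h12 h13 h23 u v w) / U ^ 2)
      by (field; lra).
    rewrite HN; field; lra. }
rewrite E; unfold bary; rewrite EN; f_equal; field; lra.
Qed.

Lemma continuity_bary_chord k h12 h13 h23 (s : R -> R -> R) x y :
  spread_pos k h12 h13 h23 -> unit_square x y -> continuity_2d_pt s x y ->
  continuity_2d_pt (fun x y =>
    bary_chord k h12 h13 h23 (s x y) (square_u x y) (square_v x y) (square_w x y)) x y.
Proof.
intros Hp Hs Hc; unfold bary_chord, Rdiv.
destruct (spread_spec k h12 h13 h23 _ _ _ Hp (square_simplex x y Hs)) as [HN _].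
apply continuity_2d_pt_mult.
- apply continuity_2d_pt_minus; auto.
  apply continuity_2d_pt_mult.
  + apply continuity_2d_pt_mult; [continuity_2d | apply continuity_pairs].
  + apply continuity_2d_pt_inv; [| lra].
    apply continuity_2d_pt_plus; [continuity_2d | apply continuity_spread; auto].
- apply continuity_2d_pt_inv; [apply continuity_spread; auto | lra].
Qed.

(** Sides of a nondegenerate triangle of the surface that lies in an open
    hemisphere when [k > 0]. *)
Definition admissible (k a b c : R) : Prop :=
  0 < a /\ 0 < b /\ 0 < c /\ a < b + c /\ b < a + c /\ c < a + b /\
  short k ((a + b + c) / 2).

Lemma hinge_strict k x y d : 0 < x -> 0 < y -> d < x + y -> x < y + d ->
  y < x + d -> short k ((x + y + d) / 2) ->
  - (sn k x * sn k y) < hinge k x y d < sn k x * sn k y.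
Proof.
intros Hx Hy H1 H2 H3 Hw; split.
- rewrite hinge_add.
  assert (0 < sn k ((x + y + d) / 2) * sn k ((x + y - d) / 2)); [| lra].
  apply Rmult_lt_0_compat; apply sn_pos; try lra.
  + auto.
  + apply short_of with ((x + y + d) / 2); [lra | auto].
- rewrite hinge_sub.
  assert (0 < sn k ((y + d - x) / 2) * sn k ((x + d - y) / 2)); [| lra].
  apply Rmult_lt_0_compat; apply sn_pos; try lra;
  apply short_of with ((x + y + d) / 2); try lra; auto.
Qed.

(** Decomposing the combination along the third vertex and orthogonally to it
    gives [(1 - k * sg) ^ 2 + k * q], where [q] is the Gram form of two linearly
    independent tangent vectors at that vertex. *)
Lemma admissible_spread (k a b c : R) : admissible k a b c ->
  spread_pos k (ms k c) (ms k b) (ms k a).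
Proof.
intros [Ha [Hb [Hc [H1 [H2 [H3 Hw]]]]]] u v w [Hu [Hv [Hw' E]]].
assert (Hh := hinge_strict k b a c Hb Ha ltac:(lra) ltac:(lra) ltac:(lra)
  ltac:(replace ((b + a + c) / 2) with ((a + b + c) / 2) by field; auto)).
assert (Pa : 0 < sn k a) by (apply sn_pos; auto; apply short_of with (2 := Hw); lra).
assert (Pb : 0 < sn k b) by (apply sn_pos; auto; apply short_of with (2 := Hw); lra).
assert (Sa := sn_ms_sqr k a); assert (Sb := sn_ms_sqr k b).
assert (Na := ms_nonneg k a); assert (Nb := ms_nonneg k b).
assert (Nc := ms_nonneg k c).
set (h := hinge k b a c) in *.
set (sg := u * ms k b + v * ms k a).
set (q := u ^ 2 * sn k b ^ 2 + v ^ 2 * sn k a ^ 2 + 2 * (u * v * h)).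
assert (EN : 1 - 2 * k * pairs (ms k c) (ms k b) (ms k a) u v w =
  (1 - k * sg) ^ 2 + k * q).
{ unfold q; rewrite Sa, Sb; unfold sg, pairs, h, hinge.
  replace w with (1 - u - v) by lra; ring. }
destruct (Rle_or_lt k 0) as [Hk | Hk].
{ assert (0 <= - k * pairs (ms k c) (ms k b) (ms k a) u v w); [| lra].
  unfold pairs; repeat first [assumption | lra | apply Rplus_le_le_0_compat | apply Rmult_le_pos]. }
rewrite EN.
assert (Hsq := pow2_ge_0 (1 - k * sg)).
destruct (Req_dec u 0) as [Eu | Nu].
- destruct (Req_dec v 0) as [Ev | Nv].
  + replace sg with 0 by (unfold sg; rewrite Eu, Ev; ring).
    replace q with 0 by (unfold q; rewrite Eu, Ev; ring); lra.
  + assert (0 < k * q); [| lra].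
    apply Rmult_lt_0_compat; auto; unfold q; rewrite Eu.
    assert (0 < v ^ 2 * sn k a ^ 2)
      by (apply Rmult_lt_0_compat; apply pow_lt; lra); lra.
- assert (0 < k * q); [| lra].
  apply Rmult_lt_0_compat; auto; unfold q.
  replace (u ^ 2 * _ + _ + _) with ((u * sn k b - v * sn k a) ^ 2 +
    2 * (u * v * (sn k b * sn k a + h))) by ring.
  assert (Hs := pow2_ge_0 (u * sn k b - v * sn k a)).
  destruct (Req_dec v 0) as [Ev | Nv].
  + subst v.
    replace (_ + _) with (u ^ 2 * sn k b ^ 2) by ring.
    apply Rmult_lt_0_compat; apply pow_lt; lra.
  + assert (0 < u * v * (sn k b * sn k a + h)); [| lra].
    apply Rmult_lt_0_compat; [apply Rmult_lt_0_compat | ]; lra.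
Qed.

(** * Triangles and attainment of [S] *)

Definition model_triangle (k a b c : R) (A B C : vec3) : Prop :=
  on_model k A /\ on_model k B /\ on_model k C /\
  model_dist k B C = a /\ model_dist k A C = b /\ model_dist k A B = c.

Lemma triangle_chord k a b c A B C : model_triangle k a b c A B C ->
  chord k A B = ms k c /\ chord k A C = ms k b /\ chord k B C = ms k a.
Proof.
intros [HA [HB [HC [Ea [Eb Ec]]]]].
rewrite <- Ea, <- Eb, <- Ec; repeat split; symmetry; apply model_dist_spec; auto.
Qed.

Definition in_hull (k : R) (A B C P : vec3) : Prop := on_model k P /\ in_cone A B C P.

Lemma min_dist_sum_exists k a b c A B C :
  admissible k a b c -> model_triangle k a b c A B C ->
  exists P, in_hull k A B C P /\
    forall Q, in_hull k A B C Q -> dist_sum k A B C P <= dist_sum k A B C Q.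
Proof.
intros Hadm Htri.
assert (Hp := admissible_spread k a b c Hadm).
destruct (triangle_chord k a b c A B C Htri) as [E12 [E13 E23]].
destruct Htri as [HA [HB [HC _]]].
set (h12 := ms k c) in *; set (h13 := ms k b) in *; set (h23 := ms k a) in *.
set (P x y := bary k h12 h13 h23 (square_u x y) (square_v x y) (square_w x y) A B C).
assert (HP := fun x y Hs => bary_spec k A B C h12 h13 h23 _ _ _ HA HB HC
  E12 E13 E23 Hp (square_simplex x y Hs)).
destruct (lsc_square_min (fun x y => dist_sum k A B C (P x y))) as [x [y [Hs Hm]]].
- unfold dist_sum; apply lsc_plus; [apply lsc_plus |].
  + apply lsc_of_ms with (k := k) (g := fun x y => bary_chord k h12 h13 h23
      (square_v x y * h12 + square_w x y * h13) (square_u x y) (square_v x y) (square_w x y)).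
    * intros x y Hs; destruct (HP x y Hs) as [M [_ [<- _]]].
      apply model_dist_spec; auto.
    * intros x y Hs; apply (continuity_bary_chord k h12 h13 h23 (fun x y => _)); auto.
      unfold square_v, square_w; continuity_2d.
  + apply lsc_of_ms with (k := k) (g := fun x y => bary_chord k h12 h13 h23
      (square_u x y * h12 + square_w x y * h23) (square_u x y) (square_v x y) (square_w x y)).
    * intros x y Hs; destruct (HP x y Hs) as [M [_ [_ [<- _]]]].
      apply model_dist_spec; auto.
    * intros x y Hs; apply (continuity_bary_chord k h12 h13 h23 (fun x y => _)); auto.
      unfold square_u, square_w; continuity_2d.
  + apply lsc_of_ms with (k := k) (g := fun x y => bary_chord k h12 h13 h23
      (square_u x y * h13 + square_v x y * h23) (square_u x y) (square_v x y) (square_w x y)).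
    * intros x y Hs; destruct (HP x y Hs) as [M [_ [_ [_ <-]]]].
      apply model_dist_spec; auto.
    * intros x y Hs; apply (continuity_bary_chord k h12 h13 h23 (fun x y => _)); auto.
      unfold square_u, square_v; continuity_2d.
- exists (P x y); split.
  + destruct (HP x y Hs) as [M1 [M2 _]]; split; auto.
  + intros Q [Q1 Q2].
    destruct (bary_surjective k A B C h12 h13 h23 Q) as [u [v [w [Huvw ->]]]]; auto.
    destruct (simplex_square u v w Huvw) as [x' [y' [Hs' [<- [<- <-]]]]].
    apply (Hm x' y' Hs').
Qed.

(** Put [C] at the pole and [A], [B] at distances [b], [a] in directions
    that make the angle given by the law of cosines. *)
Lemma triangle_exists k a b c : admissible k a b c ->
  exists A B C, model_triangle k a b c A B C.
Proof.
intros [Ha [Hb [Hc [H1 [H2 [H3 Hw]]]]]].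
assert (Hh := hinge_strict k b a c Hb Ha ltac:(lra) ltac:(lra) ltac:(lra)
  ltac:(replace ((b + a + c) / 2) with ((a + b + c) / 2) by field; auto)).
assert (Wa : short k a) by (apply short_of with (2 := Hw); lra).
assert (Wb : short k b) by (apply short_of with (2 := Hw); lra).
assert (Wc : short k c) by (apply short_of with (2 := Hw); lra).
assert (Pa := sn_pos k a Ha Wa); assert (Pb := sn_pos k b Hb Wb).
set (g := hinge k b a c / (sn k b * sn k a)).
assert (Hg : hinge k b a c = sn k b * sn k a * g) by (unfold g; field; lra).
assert (Hg1 : -1 < g < 1).
{ assert (0 < sn k b * sn k a) by (apply Rmult_lt_0_compat; auto).
  rewrite Hg in Hh; split; apply (Rmult_lt_reg_l (sn k b * sn k a)); lra. }
assert (Hsq : sqrt (1 - g ^ 2) * sqrt (1 - g ^ 2) = 1 - g ^ 2)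
  by (apply sqrt_sqrt; nra).
set (f := sqrt (1 - g ^ 2)) in *.
set (e := if Rlt_dec 0 k then sqrt k else if Rlt_dec k 0 then sqrt (- k) else 1).
set (A := Vec3 (e * sn k b) 0 (cs k b)).
set (B := Vec3 (e * (sn k a * g)) (e * (sn k a * f)) (cs k a)).
set (C := Vec3 0 0 1).
assert (Sa := cs_sn_sqr k a); assert (Sb := cs_sn_sqr k b).
assert (Hmodel : on_model k A /\ on_model k B /\ on_model k C).
{ unfold on_model, A, B, C, dot, lorentz; simpl; unfold e; curvature_cases k;
    try sqrt_facts k.
  - repeat split; intros; try lra.
    + replace (_ + _ + _) with (sqrt k * sqrt k * sn k b ^ 2 + cs k b ^ 2) by ring.
      rewrite Sb, H0; ring.
    + replace (_ + _ + _) with (sqrt k * sqrt k * sn k a ^ 2 * (g ^ 2 + f * f) +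
        cs k a ^ 2) by ring.
      rewrite Sa, H0, Hsq; ring.
  - assert (Q1 : forall t, 0 < cs k t).
    { intros t; unfold cs; destruct (Rlt_dec 0 k); [lra |].
      destruct (Rlt_dec k 0); [| lra]; unfold cosh.
      assert (E1 := exp_pos (t * sqrt (- k))).
      assert (E2 := exp_pos (- (t * sqrt (- k)))); lra. }
    repeat split; intros; auto; try lra.
    + replace (_ - _ - _) with (cs k b ^ 2 - sqrt (- k) * sqrt (- k) * sn k b ^ 2)
        by ring.
      rewrite Sb, H0; ring.
    + replace (_ - _ - _) with (cs k a ^ 2 -
        sqrt (- k) * sqrt (- k) * sn k a ^ 2 * (g ^ 2 + f * f)) by ring.
      rewrite Sa, H0, Hsq; ring.
  - repeat split; intros; try lra; unfold cs;
    destruct (Rlt_dec 0 0); try lra; reflexivity. }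
destruct Hmodel as [HA [HB HC]].
assert (EAC : chord k A C = ms k b).
{ unfold chord, A, C, dot, lorentz; simpl; rewrite !cs_ms.
  unfold e; curvature_cases k.
  - field; lra.
  - field; lra.
  - assert (H := sn_ms_sqr 0 b); nra. }
assert (EBC : chord k B C = ms k a).
{ unfold chord, B, C, dot, lorentz; simpl; rewrite !cs_ms.
  unfold e; curvature_cases k.
  - field; lra.
  - field; lra.
  - replace (_ / 2) with (sn 0 a ^ 2 * (g ^ 2 + f * f) / 2) by field.
    rewrite Hsq; assert (H := sn_ms_sqr 0 a); nra. }
assert (EAB : chord k A B = ms k c).
{ unfold hinge in Hg.
  unfold chord, A, B, dot, lorentz; simpl; rewrite !cs_ms.
  unfold e; curvature_cases k; try sqrt_facts k.
  - apply (Rmult_eq_reg_r k); [| lra]; unfold Rdiv; rewrite Rmult_assoc, Rinv_l by lra.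
    replace (sqrt k * sn k b * (sqrt k * (sn k a * g))) with
      (sqrt k * sqrt k * (sn k b * sn k a * g)) by ring.
    rewrite <- Hg, H0; ring.
  - apply (Rmult_eq_reg_r k); [| lra]; unfold Rdiv; rewrite Rmult_assoc, Rinv_l by lra.
    replace (sqrt (- k) * sn k b * (sqrt (- k) * (sn k a * g))) with
      (sqrt (- k) * sqrt (- k) * (sn k b * sn k a * g)) by ring.
    rewrite <- Hg, H0; ring.
  - replace (_ / 2) with ((sn 0 b ^ 2 + sn 0 a ^ 2 * (g ^ 2 + f * f)) / 2 -
      sn 0 b * sn 0 a * g) by field.
    rewrite Hsq, <- Hg; assert (H := sn_ms_sqr 0 a); assert (H' := sn_ms_sqr 0 b); lra. }
assert (Hdist : forall P Q d, on_model k P -> on_model k Q -> 0 < d -> short k d ->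
  chord k P Q = ms k d -> model_dist k P Q = d).
{ intros P Q d HP HQ Hd Wd E; destruct (model_dist_spec k P Q HP HQ) as [D1 [D2 D3]].
  apply (ms_inj k); auto; [lra | now apply short_weak | congruence]. }
exists A, B, C; unfold model_triangle; auto 10.
Qed.

(** * A point closer to the vertices when the curvature drops *)

Lemma derive_sign (f : R -> R) (l : R) : is_derive f 0 l -> f 0 = 0 -> 0 < l ->
  exists d, 0 < d /\ forall t, 0 < t < d -> 0 < f t.
Proof.
intros Hf H0 Hl; apply is_derive_Reals in Hf.
destruct (Hf (l / 2) ltac:(lra)) as [d Hd].
exists d; split; [apply cond_pos |]; intros t Ht.
assert (H := Hd t ltac:(lra) ltac:(rewrite Rabs_pos_eq; lra)).
rewrite Rplus_0_l, H0, Rminus_0_r in H; apply Rabs_lt_between in H.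
assert (Hq : 0 < f t / t) by lra.
replace (f t) with (f t / t * t) by (field; lra).
apply Rmult_lt_0_compat; lra.
Qed.

Lemma derive_nonneg_of_min (f : R -> R) (l : R) : is_derive f 0 l ->
  (forall t, 0 <= t <= 1 -> f 0 <= f t) -> 0 <= l.
Proof.
intros Hf Hm; apply Rnot_lt_le; intros Hl.
assert (Hg : is_derive (fun t => f 0 - f t) 0 (- l)).
{ evar_last.
  { apply (is_derive_minus (V := R_NormedModule));
      [apply (is_derive_const (V := R_NormedModule)) | exact Hf]. }
  apply Rplus_0_l. }
destruct (derive_sign _ _ Hg ltac:(apply Rminus_diag_eq; reflexivity) ltac:(lra)) as [d [Hd Hpos]].
assert (Ht : 0 < Rmin d 1 / 2 < d /\ Rmin d 1 / 2 <= 1).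
{ assert (H1 := Rmin_l d 1); assert (H2 := Rmin_r d 1).
  assert (0 < Rmin d 1) by (apply Rmin_pos; lra); lra. }
specialize (Hpos _ (proj1 Ht)); specialize (Hm (Rmin d 1 / 2) ltac:(lra)); lra.
Qed.

Lemma spread_eq k h12 h13 h23 u v w N : 0 < N ->
  N ^ 2 = 1 - 2 * k * pairs h12 h13 h23 u v w ->
  N = 1 - k * (2 * pairs h12 h13 h23 u v w / (1 + N)).
Proof.
intros HN EN; apply (Rmult_eq_reg_r (1 + N)); [| lra].
field_simplify; lra.
Qed.

(** For weights of sum [1] and norm [N], the number [2 * M / (1 + N)] is the least
    value on the surface of the weighted sum of chords to the vertices; it is
    attained at the barycentre. *)
Lemma is_derive_penalty k M N : 0 < N -> N ^ 2 = 1 - 2 * k * M ->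
  is_derive (fun M => 2 * M / (1 + sqrt (1 - 2 * k * M))) M (/ N).
Proof.
intros HN EN.
assert (ES : sqrt (1 - 2 * k * M) = N).
{ rewrite <- EN; apply sqrt_pow2; lra. }
assert (0 < 1 - 2 * k * M) by (rewrite <- EN; apply pow_lt; auto).
auto_derive.
- replace (1 + - (2 * k * M)) with (1 - 2 * k * M) by ring.
  rewrite ES; repeat split; lra.
- replace (1 + - (2 * k * M)) with (1 - 2 * k * M) by ring.
  rewrite ES; apply (Rmult_eq_reg_r (N * (1 + N) ^ 2)).
  2: { apply Rmult_integral_contrapositive; split; [| apply pow_nonzero]; lra. }
  field_simplify; try lra.
Qed.

(** First-order condition at the weights, in the direction of a vertex: along the
    segment from the weights to that vertex, [pairs] becomes
    [(1 - t) ^ 2 * M + t * (1 - t) * s]. *)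
Lemma penalty_min_stationary k M N s m mbar : 0 < N -> N ^ 2 = 1 - 2 * k * M ->
  (forall t, 0 <= t <= 1 ->
     mbar - 2 * M / (1 + N) <= (1 - t) * mbar + t * m -
       2 * ((1 - t) ^ 2 * M + t * (1 - t) * s) /
       (1 + sqrt (1 - 2 * k * ((1 - t) ^ 2 * M + t * (1 - t) * s)))) ->
  0 <= m - mbar - (s - 2 * M) / N.
Proof.
intros HN EN Hm.
assert (ES : sqrt (1 - 2 * k * M) = N).
{ rewrite <- EN; apply sqrt_pow2; lra. }
set (G := fun M => 2 * M / (1 + sqrt (1 - 2 * k * M))).
set (q := fun t => (1 - t) ^ 2 * M + t * (1 - t) * s).
apply (derive_nonneg_of_min (fun t => (1 - t) * mbar + t * m - G (q t))).
- evar_last.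
  { apply (is_derive_minus (V := R_NormedModule)).
    - instantiate (1 := m - mbar); auto_derive; [trivial | ring].
    - apply (is_derive_comp G q).
      + replace (q 0) with M by (unfold q; ring).
        apply is_derive_penalty; eauto.
      + instantiate (1 := s - 2 * M); unfold q; auto_derive; [trivial | ring]. }
  unfold minus, plus, opp, scal; simpl; unfold mult; simpl; field; lra.
- intros t Ht; specialize (Hm t Ht); fold (q t) in Hm; fold (G (q t)) in Hm.
  replace (q 0) with M by (unfold q; ring).
  unfold G at 1; rewrite ES; lra.
Qed.

(** Minimax argument.  To find a point whose chords to the vertices do not exceed
    [m1], [m2], [m3], minimise over the weights the gap between the weighted sum
    of the [m_i] and the least weighted sum of chords.  At minimising weights,
    stationarity says that at the barycentre each chord is below [m_i] by at
    least the gap.  A negative gap would be, up to a positive factor, a value of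
    the quadratic form in the hypothesis, so there is none; when the gap
    vanishes, the defect of each chord is, up to a positive factor, a component
    of the gradient of that form. *)
Lemma minimax_barycentre k h12 h13 h23 m1 m2 m3 :
  spread_pos k h12 h13 h23 -> 0 <= m1 -> 0 <= m2 -> 0 <= m3 ->
  (forall u v w, simplex u v w ->
    0 <= qform (2 * m1 - k * m1 ^ 2) (2 * m2 - k * m2 ^ 2) (2 * m3 - k * m3 ^ 2)
    (m1 + m2 - h12 - k * (m1 * m2)) (m1 + m3 - h13 - k * (m1 * m3))
    (m2 + m3 - h23 - k * (m2 * m3)) u v w) ->
  exists u v w, simplex u v w /\
    let X1 := bary_chord k h12 h13 h23 (v * h12 + w * h13) u v w in
    let X2 := bary_chord k h12 h13 h23 (u * h12 + w * h23) u v w in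
    let X3 := bary_chord k h12 h13 h23 (u * h13 + v * h23) u v w in
    let t12 := m1 + m2 - h12 - k * (m1 * m2) in
    let t13 := m1 + m3 - h13 - k * (m1 * m3) in
    let t23 := m2 + m3 - h23 - k * (m2 * m3) in
    X1 <= m1 /\ X2 <= m2 /\ X3 <= m3 /\
    (X1 = m1 -> X2 = m2 -> X3 = m3 ->
      u * (2 * m1 - k * m1 ^ 2) + v * t12 + w * t13 = 0 /\
      u * t12 + v * (2 * m2 - k * m2 ^ 2) + w * t23 = 0 /\
      u * t13 + v * t23 + w * (2 * m3 - k * m3 ^ 2) = 0).
Proof.
intros Hp Hm1 Hm2 Hm3 Hq.
(* the subtracted term is the least weighted sum of chords to the vertices *)
set (Psi u v w := u * m1 + v * m2 + w * m3 -
  2 * pairs h12 h13 h23 u v w / (1 + spread k h12 h13 h23 u v w)).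
destruct (lsc_square_min (fun x y => Psi (square_u x y) (square_v x y) (square_w x y)))
  as [x [y [Hs Hmin]]].
{ intros x y c Hs Hc.
  apply (locally_2d_impl (fun x y => c < Psi (square_u x y) (square_v x y) (square_w x y)));
    [apply locally_2d_forall; auto |].
  apply (continuity_2d_gt (fun x y => Psi (square_u x y) (square_v x y) (square_w x y))); auto.
  unfold Psi; apply continuity_2d_pt_minus; [unfold square_u, square_v, square_w; continuity_2d |].
  unfold Rdiv; apply continuity_2d_pt_mult.
  - apply continuity_2d_pt_mult; [continuity_2d | apply continuity_pairs].
  - destruct (spread_spec k h12 h13 h23 _ _ _ Hp (square_simplex x y Hs)) as [HN _].
    apply continuity_2d_pt_inv; [| lra].
    apply continuity_2d_pt_plus; [continuity_2d | apply continuity_spread; auto]. }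
assert (Hsim := square_simplex x y Hs).
assert (Hmin' : forall u' v' w', simplex u' v' w' ->
  Psi (square_u x y) (square_v x y) (square_w x y) <= Psi u' v' w').
{ intros u' v' w' H; destruct (simplex_square u' v' w' H)
    as [x' [y' [H1 [<- [<- <-]]]]]; apply Hmin; auto. }
set (u := square_u x y) in *; set (v := square_v x y) in *; set (w := square_w x y) in *.
exists u, v, w; split; auto; intros X1 X2 X3 t12 t13 t23.
destruct (spread_spec k h12 h13 h23 u v w Hp Hsim) as [HN EN].
specialize (Hq u v w Hsim).
destruct Hsim as [Hu [Hv [Hw E]]].
assert (EW := spread_eq k h12 h13 h23 u v w _ HN EN).
unfold X1, X2, X3, bary_chord in *; clear X1 X2 X3.
assert (K1 : 0 <= m1 - (u * m1 + v * m2 + w * m3) -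
  (v * h12 + w * h13 - 2 * pairs h12 h13 h23 u v w) / spread k h12 h13 h23 u v w).
{ apply penalty_min_stationary with k; auto; intros t Ht.
  eapply Rle_trans; [apply (Hmin' (u + t * (1 - u)) (v - t * v) (w - t * w)) |].
  - assert (t * v <= 1 * v) by (apply Rmult_le_compat_r; lra).
    assert (t * w <= 1 * w) by (apply Rmult_le_compat_r; lra).
    assert (0 <= t * (1 - u)) by (apply Rmult_le_pos; lra).
    assert (t * (1 - u) = t * v + t * w)
      by (replace (1 - u) with (v + w) by lra; ring).
    repeat split; lra.
  - right; unfold Psi, spread.
    replace (pairs h12 h13 h23 (u + t * (1 - u)) (v - t * v) (w - t * w)) with
      ((1 - t) ^ 2 * pairs h12 h13 h23 u v w + t * (1 - t) * (v * h12 + w * h13))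
      by (unfold pairs; ring).
    f_equal; ring. }
assert (K2 : 0 <= m2 - (u * m1 + v * m2 + w * m3) -
  (u * h12 + w * h23 - 2 * pairs h12 h13 h23 u v w) / spread k h12 h13 h23 u v w).
{ apply penalty_min_stationary with k; auto; intros t Ht.
  eapply Rle_trans; [apply (Hmin' (u - t * u) (v + t * (1 - v)) (w - t * w)) |].
  - assert (t * u <= 1 * u) by (apply Rmult_le_compat_r; lra).
    assert (t * w <= 1 * w) by (apply Rmult_le_compat_r; lra).
    assert (0 <= t * (1 - v)) by (apply Rmult_le_pos; lra).
    assert (t * (1 - v) = t * u + t * w)
      by (replace (1 - v) with (u + w) by lra; ring).
    repeat split; lra.
  - right; unfold Psi, spread.
    replace (pairs h12 h13 h23 (u - t * u) (v + t * (1 - v)) (w - t * w)) with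
      ((1 - t) ^ 2 * pairs h12 h13 h23 u v w + t * (1 - t) * (u * h12 + w * h23))
      by (unfold pairs; ring).
    f_equal; ring. }
assert (K3 : 0 <= m3 - (u * m1 + v * m2 + w * m3) -
  (u * h13 + v * h23 - 2 * pairs h12 h13 h23 u v w) / spread k h12 h13 h23 u v w).
{ apply penalty_min_stationary with k; auto; intros t Ht.
  eapply Rle_trans; [apply (Hmin' (u - t * u) (v - t * v) (w + t * (1 - w))) |].
  - assert (t * u <= 1 * u) by (apply Rmult_le_compat_r; lra).
    assert (t * v <= 1 * v) by (apply Rmult_le_compat_r; lra).
    assert (0 <= t * (1 - w)) by (apply Rmult_le_pos; lra).
    assert (t * (1 - w) = t * u + t * v)
      by (replace (1 - w) with (u + v) by lra; ring).
    repeat split; lra.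
  - right; unfold Psi, spread.
    replace (pairs h12 h13 h23 (u - t * u) (v - t * v) (w + t * (1 - w))) with
      ((1 - t) ^ 2 * pairs h12 h13 h23 u v w + t * (1 - t) * (u * h13 + v * h23))
      by (unfold pairs; ring).
    f_equal; ring. }
clear Hmin Hmin' Psi.
set (N := spread k h12 h13 h23 u v w) in *.
set (mbar := u * m1 + v * m2 + w * m3) in *.
set (M := pairs h12 h13 h23 u v w) in *.
set (W := 2 * M / (1 + N)) in *.
assert (E2M : 2 * M = W * (1 + N)) by (unfold W; field; lra).
assert (Hmbar : 0 <= mbar).
{ unfold mbar; repeat apply Rplus_le_le_0_compat; apply Rmult_le_pos; auto. }
(* the form in the hypothesis is the gap times a factor, positive for gap [<= 0] *)
assert (EQ : qform (2 * m1 - k * m1 ^ 2) (2 * m2 - k * m2 ^ 2)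
  (2 * m3 - k * m3 ^ 2) t12 t13 t23 u v w = (mbar - W) * (N + 1 - k * mbar)).
{ transitivity (2 * mbar - 2 * M - k * mbar ^ 2).
  - unfold qform, t12, t13, t23, mbar, M, pairs.
    replace w with (1 - u - v) by lra; ring.
  - rewrite E2M, EW; ring. }
fold t12 t13 t23 in Hq; rewrite EQ in Hq.
assert (HPsi : W <= mbar).
{ apply Rnot_lt_le; intros Hlt.
  assert (A : N + 1 - k * mbar <= 0).
  { apply Rnot_lt_le; intros B.
    assert (0 < (W - mbar) * (N + 1 - k * mbar))
      by (apply Rmult_lt_0_compat; lra); lra. }
  assert (0 < k * (mbar - W)) by lra.
  destruct (Rle_or_lt k 0).
  - assert (0 <= - k * mbar) by (apply Rmult_le_pos; lra); lra.
  - assert (0 < k * (W - mbar)) by (apply Rmult_lt_0_compat; lra); lra. }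
assert (KX : forall m s, 0 <= m - mbar - (s - 2 * M) / N ->
  mbar - W <= m - (s - W) / N).
{ intros m s H; rewrite E2M in H.
  replace ((s - W * (1 + N)) / N) with ((s - W) / N - W) in H by (field; lra).
  lra. }
apply KX in K1; apply KX in K2; apply KX in K3.
repeat split; try lra; assert (HW : W = mbar) by lra; rewrite HW in *;
  [clear H0 H1 | clear H H1 | clear H H0];
  match goal with H : ?e / N = ?m |- _ =>
    assert (e = N * m) by (rewrite <- H; field; lra) end;
  rewrite EW in *; unfold t12, t13, t23.
- transitivity (m1 + mbar - (v * h12 + w * h13) - k * mbar * m1); [| lra].
  unfold mbar; replace u with (1 - v - w) by lra; ring.
- transitivity (m2 + mbar - (u * h12 + w * h23) - k * mbar * m2); [| lra].
  unfold mbar; replace u with (1 - v - w) by lra; ring.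
- transitivity (m3 + mbar - (u * h13 + v * h23) - k * mbar * m3); [| lra].
  unfold mbar; replace u with (1 - v - w) by lra; ring.
Qed.

(** The form of the [c_ij] lies between [0] and the form of the [d_ij] on
    nonnegative vectors, so it vanishes at [(x, y, z)] too and, being
    nonnegative everywhere, has zero gradient there.  Subtracting the two
    gradients leaves sums of nonnegative terms; as at least two of [x], [y], [z]
    are positive, each difference [d_ij - c_ij] occurs with a positive
    coefficient. *)
Lemma gram_dominated_null c12 c13 c23 d12 d13 d23 x y z :
  (forall x y z, 0 <= qform 1 1 1 c12 c13 c23 x y z) ->
  c12 <= d12 -> c13 <= d13 -> c23 <= d23 ->
  0 <= x -> 0 <= y -> 0 <= z -> x + y + z <> 0 ->
  x + y * d12 + z * d13 = 0 -> x * d12 + y + z * d23 = 0 ->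
  x * d13 + y * d23 + z = 0 ->
  c12 = d12 /\ c13 = d13 /\ c23 = d23.
Proof.
intros Hq H12 H13 H23 Hx Hy Hz Hne E1 E2 E3.
assert (Hxy : 0 <= x * y) by (apply Rmult_le_pos; auto).
assert (Hxz : 0 <= x * z) by (apply Rmult_le_pos; auto).
assert (Hyz : 0 <= y * z) by (apply Rmult_le_pos; auto).
assert (F : qform 1 1 1 c12 c13 c23 x y z <= 0).
{ replace 0 with (x * (x + y * d12 + z * d13) + y * (x * d12 + y + z * d23) +
    z * (x * d13 + y * d23 + z)) by (rewrite E1, E2, E3; ring).
  unfold qform.
  assert (0 <= x * y * (d12 - c12)) by (apply Rmult_le_pos; lra).
  assert (0 <= x * z * (d13 - c13)) by (apply Rmult_le_pos; lra).
  assert (0 <= y * z * (d23 - c23)) by (apply Rmult_le_pos; lra).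
  lra. }
assert (Hnull : forall r, 0 <= - r ^ 2 -> r = 0).
{ intros r Hr; assert (H := pow2_ge_0 r).
  apply Rsqr_0_uniq; unfold Rsqr; lra. }
(* test the form at the vector moved against its own gradient *)
assert (R1 : x + y * c12 + z * c13 = 0).
{ apply Hnull; assert (H := Hq (x - (x + y * c12 + z * c13)) y z).
  unfold qform in *; lra. }
assert (R2 : x * c12 + y + z * c23 = 0).
{ apply Hnull; assert (H := Hq x (y - (x * c12 + y + z * c23)) z).
  unfold qform in *; lra. }
assert (R3 : x * c13 + y * c23 + z = 0).
{ apply Hnull; assert (H := Hq x y (z - (x * c13 + y * c23 + z))).
  unfold qform in *; lra. }
assert (P : forall t e, 0 <= t -> 0 <= e -> 0 <= t * e)
  by (intros; apply Rmult_le_pos; auto).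
assert (A1 := P y (d12 - c12) Hy ltac:(lra)).
assert (A2 := P z (d13 - c13) Hz ltac:(lra)).
assert (A3 := P x (d12 - c12) Hx ltac:(lra)).
assert (A4 := P z (d23 - c23) Hz ltac:(lra)).
assert (A5 := P x (d13 - c13) Hx ltac:(lra)).
assert (A6 := P y (d23 - c23) Hy ltac:(lra)).
assert (Z : forall t e, t * e = 0 -> e <> 0 -> t = 0).
{ intros t e H He; apply Rmult_integral in H; tauto. }
split; [| split].
- apply NNPP; intros Hn.
  assert (x = 0) by (apply Z with (d12 - c12); lra).
  assert (y = 0) by (apply Z with (d12 - c12); lra).
  subst; lra.
- apply NNPP; intros Hn.
  assert (x = 0) by (apply Z with (d13 - c13); lra).
  assert (z = 0) by (apply Z with (d13 - c13); lra).
  subst; lra.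
- apply NNPP; intros Hn.
  assert (y = 0) by (apply Z with (d23 - c23); lra).
  assert (z = 0) by (apply Z with (d23 - c23); lra).
  subst; lra.
Qed.

Definition hinge_form (k a b c x1 x2 x3 u v w : R) : R :=
  qform (sn k x1 ^ 2) (sn k x2 ^ 2) (sn k x3 ^ 2)
    (hinge k x1 x2 c) (hinge k x1 x3 b) (hinge k x2 x3 a) u v w.

Lemma hinge_form_cos k a b c x1 x2 x3 u v w :
  sn k x1 <> 0 -> sn k x2 <> 0 -> sn k x3 <> 0 ->
  hinge_form k a b c x1 x2 x3 u v w =
  qform 1 1 1 (angle_cos k x1 x2 c) (angle_cos k x1 x3 b) (angle_cos k x2 x3 a)
    (u * sn k x1) (v * sn k x2) (w * sn k x3).
Proof. intros; unfold hinge_form, qform, angle_cos; field; auto. Qed.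

Definition triangle_ineq (x y d : R) : Prop := d <= x + y /\ x <= y + d /\ y <= x + d.

Lemma angle_cos_straight k x y : 0 < x -> 0 < y -> short k x -> short k y ->
  angle_cos k x y (x + y) = -1.
Proof.
intros Hx Hy Wx Wy; unfold angle_cos; rewrite hinge_add.
replace ((x + y - (x + y)) / 2) with 0 by field; rewrite sn_0.
assert (H1 := sn_pos k x Hx Wx); assert (H2 := sn_pos k y Hy Wy); field; lra.
Qed.

Lemma angle_cos_aligned k x y d : 0 < x -> 0 < y -> short k x -> short k y ->
  x = y + d \/ y = x + d -> angle_cos k x y d = 1.
Proof.
intros Hx Hy Wx Wy Hd; unfold angle_cos; rewrite hinge_sub.
assert (H1 := sn_pos k x Hx Wx); assert (H2 := sn_pos k y Hy Wy).
destruct Hd as [Hd | Hd].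
- replace ((y + d - x) / 2) with 0 by lra; rewrite sn_0; field; lra.
- replace ((x + d - y) / 2) with 0 by lra; rewrite sn_0; field; lra.
Qed.

(** Kirszbraun's theorem for the isometry from three points of the surface of
    curvature [k2] to three points of the surface of curvature [k1], extended to
    one more point, at distances [x1], [x2], [x3].  Its angles at that point
    decrease when the curvature drops, so the Gram form of the directions stays
    nonnegative on nonnegative weights, and the minimax argument applies.  If no
    distance decreased, all the comparison angles would be those of curvature
    [k2], so that the four points would be aligned, against the strict triangle
    inequalities of the sides. *)
Lemma kirszbraun_triangle k1 k2 a b c A B C x1 x2 x3 :
  admissible k1 a b c -> model_triangle k1 a b c A B C -> k1 < k2 ->
  0 < x1 -> 0 < x2 -> 0 < x3 -> short k2 x1 -> short k2 x2 -> short k2 x3 ->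
  triangle_ineq x1 x2 c -> triangle_ineq x1 x3 b -> triangle_ineq x2 x3 a ->
  (forall u v w, 0 <= hinge_form k2 a b c x1 x2 x3 u v w) ->
  exists P, in_hull k1 A B C P /\ dist_sum k1 A B C P < x1 + x2 + x3.
Proof.
intros Hadm Htri Hk P1 P2 P3 W1 W2 W3 [T1 [T2 T3]] [T4 [T5 T6]] [T7 [T8 T9]] Hform.
assert (Hp := admissible_spread k1 a b c Hadm).
destruct (triangle_chord k1 a b c A B C Htri) as [E12 [E13 E23]].
destruct Htri as [HA [HB [HC _]]].
assert (V1 : short k1 x1) by (apply short_curvature with k2; auto; lra).
assert (V2 : short k1 x2) by (apply short_curvature with k2; auto; lra).
assert (V3 : short k1 x3) by (apply short_curvature with k2; auto; lra).
assert (Q1 := sn_pos k1 x1 P1 V1); assert (R1 := sn_pos k2 x1 P1 W1).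
assert (Q2 := sn_pos k1 x2 P2 V2); assert (R2 := sn_pos k2 x2 P2 W2).
assert (Q3 := sn_pos k1 x3 P3 V3); assert (R3 := sn_pos k2 x3 P3 W3).
destruct (angle_cos_mono k1 k2 x1 x2 c) as [C12 F12]; auto.
destruct (angle_cos_mono k1 k2 x1 x3 b) as [C13 F13]; auto.
destruct (angle_cos_mono k1 k2 x2 x3 a) as [C23 F23]; auto.
assert (Hcos : forall u v w, 0 <= qform 1 1 1 (angle_cos k2 x1 x2 c)
  (angle_cos k2 x1 x3 b) (angle_cos k2 x2 x3 a) u v w).
{ intros u v w; assert (H := Hform (u / sn k2 x1) (v / sn k2 x2) (w / sn k2 x3)).
  rewrite hinge_form_cos in H by lra.
  replace (u / sn k2 x1 * sn k2 x1) with u in H by (field; lra).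
  replace (v / sn k2 x2 * sn k2 x2) with v in H by (field; lra).
  replace (w / sn k2 x3 * sn k2 x3) with w in H by (field; lra).
  exact H. }
destruct (minimax_barycentre k1 (ms k1 c) (ms k1 b) (ms k1 a) (ms k1 x1) (ms k1 x2) (ms k1 x3))
  as [u [v [w [Hsim [L1 [L2 [L3 Hnull]]]]]]]; auto using ms_nonneg.
{ intros u v w [Hu [Hv [Hw _]]]; rewrite <- !sn_ms_sqr.
  change (0 <= hinge_form k1 a b c x1 x2 x3 u v w).
  rewrite hinge_form_cos by lra.
  apply Rle_trans with (1 := Hcos (u * sn k1 x1) (v * sn k1 x2) (w * sn k1 x3)).
  unfold qform; apply Rplus_le_compat_l, Rmult_le_compat_l; [lra |].
  repeat apply Rplus_le_compat; apply Rmult_le_compat_r; auto;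
    repeat apply Rmult_le_pos; lra. }
destruct (bary_spec k1 A B C _ _ _ u v w HA HB HC E12 E13 E23 Hp Hsim)
  as [M1 [M2 [D1 [D2 D3]]]].
set (P := bary k1 _ _ _ u v w A B C) in *.
rewrite <- D1 in L1, Hnull; rewrite <- D2 in L2, Hnull; rewrite <- D3 in L3, Hnull.
destruct (model_dist_spec k1 P A M1 HA) as [X1 [Y1 Z1]].
destruct (model_dist_spec k1 P B M1 HB) as [X2 [Y2 Z2]].
destruct (model_dist_spec k1 P C M1 HC) as [X3 [Y3 Z3]].
rewrite <- Z1 in L1, Hnull; rewrite <- Z2 in L2, Hnull; rewrite <- Z3 in L3, Hnull.
apply ms_le_inv in L1; auto; [| lra].
apply ms_le_inv in L2; auto; [| lra].
apply ms_le_inv in L3; auto; [| lra].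
exists P; split; [split; auto |].
unfold dist_sum; apply Rnot_le_lt; intros Hge.
assert (G1 : model_dist k1 P A = x1) by lra.
assert (G2 : model_dist k1 P B = x2) by lra.
assert (G3 : model_dist k1 P C = x3) by lra.
rewrite G1, G2, G3, <- !sn_ms_sqr in Hnull.
destruct (Hnull eq_refl eq_refl eq_refl) as [N1 [N2 N3]].
fold (hinge k1 x1 x2 c) in N1, N2; fold (hinge k1 x1 x3 b) in N1, N3.
fold (hinge k1 x2 x3 a) in N2, N3.
destruct Hsim as [Hu [Hv [Hw Esum]]].
assert (S1 : 0 <= u * sn k1 x1) by (apply Rmult_le_pos; lra).
assert (S2 : 0 <= v * sn k1 x2) by (apply Rmult_le_pos; lra).
assert (S3 : 0 <= w * sn k1 x3) by (apply Rmult_le_pos; lra).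
destruct (gram_dominated_null (angle_cos k2 x1 x2 c) (angle_cos k2 x1 x3 b)
  (angle_cos k2 x2 x3 a) (angle_cos k1 x1 x2 c) (angle_cos k1 x1 x3 b)
  (angle_cos k1 x2 x3 a) (u * sn k1 x1) (v * sn k1 x2) (w * sn k1 x3))
  as [B12 [B13 B23]]; auto.
- intros Hz.
  assert (Z : forall t e, t * e = 0 -> e <> 0 -> t = 0)
    by (intros t e H He; apply Rmult_integral in H; tauto).
  assert (u = 0) by (apply Z with (sn k1 x1); lra).
  assert (v = 0) by (apply Z with (sn k1 x2); lra).
  assert (w = 0) by (apply Z with (sn k1 x3); lra).
  lra.
- unfold angle_cos; apply (Rmult_eq_reg_r (sn k1 x1)); [| lra].
  field_simplify; lra.
- unfold angle_cos; apply (Rmult_eq_reg_r (sn k1 x2)); [| lra].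
  field_simplify; lra.
- unfold angle_cos; apply (Rmult_eq_reg_r (sn k1 x3)); [| lra].
  field_simplify; lra.
- destruct Hadm as [Pa [Pb [Pc [I1 [I2 [I3 _]]]]]].
  specialize (F12 B12); specialize (F13 B13); specialize (F23 B23).
  destruct F12 as [F12 | [F12 | F12]], F13 as [F13 | [F13 | F13]],
    F23 as [F23 | [F23 | F23]]; try lra.
  + assert (H := Hcos 1 1 1); rewrite F12, F13, F23, !angle_cos_straight in H; auto.
    unfold qform in H; lra.
  + assert (H := Hcos 1 1 (-1)).
    rewrite F12, angle_cos_straight, !angle_cos_aligned in H; auto.
    unfold qform in H; lra.
  + assert (H := Hcos (-1) 1 1).
    rewrite F23, angle_cos_straight, !angle_cos_aligned in H; auto.
    unfold qform in H; lra.
  + assert (H := Hcos 1 (-1) 1).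
    rewrite F13, angle_cos_straight, !angle_cos_aligned in H; auto.
    unfold qform in H; lra.
Qed.

(** * Vertices and points antipodal to them *)

Lemma sn_zero_cases k x : 0 <= x -> short_le k x ->
  (sn k x = 0 -> 0 < x -> forall s, short k s -> s < x) /\
  (sn k x <> 0 -> 0 < x /\ short k x).
Proof.
intros Hx Hw; split.
- intros H0 Hp s Hs; apply Rnot_le_lt; intros Hle.
  assert (H := sn_pos k x Hp (short_of k x s Hle Hs)); lra.
- intros Hne; assert (Hp : 0 < x).
  { destruct (Req_dec x 0) as [-> |]; [rewrite sn_0 in Hne |]; lra. }
  split; auto; intros Hk; destruct (Hw Hk) as [| E]; auto.
  destruct Hne; unfold sn; destruct (Rlt_dec 0 k); [| lra].
  rewrite E, sin_PI; apply Rmult_0_l.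
Qed.

(** A point at distance [x] with [sn k x = 0] is either the vertex itself or its
    antipode, and then the distance to any other point is known. *)
Lemma end_dist k x y d : 0 <= x -> 0 <= y -> 0 <= d ->
  short_le k x -> short_le k y -> short k d -> sn k x = 0 -> hinge k x y d = 0 ->
  (x = 0 /\ y = d) \/ (0 < x /\ y = x - d /\ forall s, short k s -> s < x).
Proof.
intros Hx Hy Hd Wx Wy Wd Hsn Hh.
destruct Hx as [Hx | <-].
- right; assert (Hs := proj1 (sn_zero_cases k x (Rlt_le _ _ Hx) Wx) Hsn Hx).
  assert (Hdx := Hs d Wd); repeat split; auto.
  apply (ms_inj k); auto; try lra.
  + apply short_le_of with x; [lra | auto].
  + rewrite ms_diff, Hsn; unfold hinge in Hh.
    assert (Hpos := ms_incr k 0 x (Rle_refl 0) Hx Wx); rewrite ms_0 in Hpos.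
    assert (E := sn_ms_sqr k x); rewrite Hsn in E.
    assert (Ek : k * ms k x = 2).
    { apply (Rmult_eq_reg_r (ms k x)); [| lra]; lra. }
    replace (k * (ms k x * ms k y)) with (k * ms k x * ms k y) in Hh by ring.
    replace (k * (ms k x * ms k d)) with (k * ms k x * ms k d) by ring.
    rewrite Ek in *; lra.
- left; split; auto; apply (ms_inj k); auto; [now apply short_weak |].
  unfold hinge in Hh; rewrite ms_0 in Hh; lra.
Qed.

Lemma hinge_sym k x y d : hinge k x y d = hinge k y x d.
Proof. unfold hinge; ring. Qed.

(** The triangle inequalities, read off the half-angle formulas. *)
Lemma triangle_ineq_of_hinge k x y d :
  0 < x -> 0 < y -> 0 <= d -> short k x -> short k y -> short_le k d ->
  - (sn k x * sn k y) <= hinge k x y d <= sn k x * sn k y -> triangle_ineq x y d.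
Proof.
intros Hx Hy Hd Wx Wy Wd [H1 H2].
assert (D : d <= x + y).
{ apply Rnot_lt_le; intros Hlt; rewrite hinge_add in H1.
  replace ((x + y - d) / 2) with (- ((d - x - y) / 2)) in H1 by field.
  rewrite sn_opp in H1.
  assert (0 < sn k ((x + y + d) / 2) * sn k ((d - x - y) / 2)); [| lra].
  apply Rmult_lt_0_compat; apply sn_pos; try lra;
    apply short_of_lt with d; auto; lra. }
assert (G : forall x y, 0 < x -> 0 < y -> short k x -> short k y -> d <= x + y ->
  hinge k x y d <= sn k x * sn k y -> x <= y + d).
{ clear - Hd Wd; intros x y Hx Hy Wx Wy D H2.
  apply Rnot_lt_le; intros Hlt; rewrite hinge_sub in H2.
  replace ((y + d - x) / 2) with (- ((x - y - d) / 2)) in H2 by field.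
  rewrite sn_opp in H2.
  assert (0 < sn k ((x - y - d) / 2) * sn k ((x + d - y) / 2)); [| lra].
  apply Rmult_lt_0_compat; apply sn_pos; try lra;
    apply short_of with x; auto; lra. }
repeat split; auto.
apply G; auto; [lra |]; rewrite hinge_sym; lra.
Qed.

Lemma psd_offdiag_zero t11 t22 t12 : t11 = 0 ->
  (forall u v, 0 <= t11 * u ^ 2 + t22 * v ^ 2 + 2 * (t12 * (u * v))) -> t12 = 0.
Proof.
intros -> H; apply NNPP; intros Hne.
assert (H' := H (- (t22 + 1) / (2 * t12)) 1).
replace (2 * (t12 * (- (t22 + 1) / (2 * t12) * 1))) with (- (t22 + 1)) in H'
  by (field; auto).
lra.
Qed.

Lemma hinge_bound k x y d : 0 < x -> 0 < y -> short k x -> short k y ->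
  (forall u v, 0 <= sn k x ^ 2 * u ^ 2 + sn k y ^ 2 * v ^ 2 +
     2 * (hinge k x y d * (u * v))) ->
  - (sn k x * sn k y) <= hinge k x y d <= sn k x * sn k y.
Proof.
intros Hx Hy Wx Wy H.
assert (Px := sn_pos k x Hx Wx); assert (Py := sn_pos k y Hy Wy).
assert (P := Rmult_lt_0_compat _ _ Px Py).
assert (H1 := H (sn k y) (sn k x)); assert (H2 := H (sn k y) (- sn k x)).
split; apply (Rmult_le_reg_l (sn k x * sn k y)); auto; lra.
Qed.

(** At a vertex the sum of the distances is that of two sides; at the antipode
    of a vertex it is even larger, because the perimeter is less than a great
    circle. *)
Lemma vertex_or_generic k a b c A B C P :
  admissible k a b c -> a <= b -> b <= c -> model_triangle k a b c A B C ->
  on_model k P ->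
  let x1 := model_dist k P A in
  let x2 := model_dist k P B in
  let x3 := model_dist k P C in
  (forall u v w, 0 <= hinge_form k a b c x1 x2 x3 u v w) /\
  (a + b <= x1 + x2 + x3 \/
   (0 < x1 /\ 0 < x2 /\ 0 < x3) /\ (short k x1 /\ short k x2 /\ short k x3) /\
   triangle_ineq x1 x2 c /\ triangle_ineq x1 x3 b /\ triangle_ineq x2 x3 a).
Proof.
intros Hadm Hab Hbc Htri HP x1 x2 x3.
destruct (triangle_chord k a b c A B C Htri) as [E12 [E13 E23]].
destruct Htri as [HA [HB [HC _]]].
destruct (model_dist_spec k P A HP HA) as [X1 [Y1 Z1]]; fold x1 in X1, Y1, Z1.
destruct (model_dist_spec k P B HP HB) as [X2 [Y2 Z2]]; fold x2 in X2, Y2, Z2.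
destruct (model_dist_spec k P C HP HC) as [X3 [Y3 Z3]]; fold x3 in X3, Y3, Z3.
assert (Hform : forall u v w, 0 <= hinge_form k a b c x1 x2 x3 u v w).
{ intros u v w; unfold hinge_form, hinge; rewrite !sn_ms_sqr.
  apply (hinge_form_nonneg k P A B C); auto. }
split; [exact Hform |].
destruct Hadm as [Ha [Hb [Hc [I1 [I2 [I3 Hw]]]]]].
assert (Wa : short k a) by (apply short_of with (2 := Hw); lra).
assert (Wb : short k b) by (apply short_of with (2 := Hw); lra).
assert (Wc : short k c) by (apply short_of with (2 := Hw); lra).
assert (F12 : forall u v, 0 <= sn k x1 ^ 2 * u ^ 2 + sn k x2 ^ 2 * v ^ 2 +
  2 * (hinge k x1 x2 c * (u * v))).
{ intros u v; assert (H := Hform u v 0); unfold hinge_form, qform in H; lra. }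
assert (F13 : forall u v, 0 <= sn k x1 ^ 2 * u ^ 2 + sn k x3 ^ 2 * v ^ 2 +
  2 * (hinge k x1 x3 b * (u * v))).
{ intros u v; assert (H := Hform u 0 v); unfold hinge_form, qform in H; lra. }
assert (F23 : forall u v, 0 <= sn k x2 ^ 2 * u ^ 2 + sn k x3 ^ 2 * v ^ 2 +
  2 * (hinge k x2 x3 a * (u * v))).
{ intros u v; assert (H := Hform 0 u v); unfold hinge_form, qform in H; lra. }
assert (Hend : forall x y d, 0 <= x -> 0 <= y -> 0 < d -> short_le k x ->
  short_le k y -> short k d -> sn k x = 0 ->
  (forall u v, 0 <= sn k x ^ 2 * u ^ 2 + sn k y ^ 2 * v ^ 2 +
     2 * (hinge k x y d * (u * v))) ->
  (x = 0 /\ y = d) \/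
  (0 < x /\ y = x - d /\ (a + b + c) / 2 < x)).
{ intros x y d Q1 Q2 Q3 Q4 Q5 Q6 Q7 Q8.
  assert (H0 : hinge k x y d = 0).
  { apply psd_offdiag_zero with (2 := Q8); rewrite Q7; ring. }
  destruct (end_dist k x y d) as [H | [H1 [H2 H3]]]; auto; lra. }
assert (S12 : forall u v, 0 <= sn k x2 ^ 2 * u ^ 2 + sn k x1 ^ 2 * v ^ 2 +
  2 * (hinge k x2 x1 c * (u * v))).
{ intros u v; rewrite hinge_sym; assert (H := F12 v u); lra. }
assert (S13 : forall u v, 0 <= sn k x3 ^ 2 * u ^ 2 + sn k x1 ^ 2 * v ^ 2 +
  2 * (hinge k x3 x1 b * (u * v))).
{ intros u v; rewrite hinge_sym; assert (H := F13 v u); lra. }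
assert (S23 : forall u v, 0 <= sn k x3 ^ 2 * u ^ 2 + sn k x2 ^ 2 * v ^ 2 +
  2 * (hinge k x3 x2 a * (u * v))).
{ intros u v; rewrite hinge_sym; assert (H := F23 v u); lra. }
destruct (Req_dec (sn k x1) 0) as [N1 | N1].
{ left; destruct (Hend x1 x2 c); destruct (Hend x1 x3 b); auto; lra. }
destruct (Req_dec (sn k x2) 0) as [N2 | N2].
{ left; destruct (Hend x2 x1 c); destruct (Hend x2 x3 a); auto; lra. }
destruct (Req_dec (sn k x3) 0) as [N3 | N3].
{ left; destruct (Hend x3 x1 b); destruct (Hend x3 x2 a); auto; lra. }
right.
destruct (proj2 (sn_zero_cases k x1 X1 Y1) N1) as [P1 W1].
destruct (proj2 (sn_zero_cases k x2 X2 Y2) N2) as [P2 W2].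
destruct (proj2 (sn_zero_cases k x3 X3 Y3) N3) as [P3 W3].
split; [auto |]; split; [auto |].
split; [| split]; apply (triangle_ineq_of_hinge k); try apply hinge_bound;
  auto using short_weak; lra.
Qed.

(** Leave the vertex [C] along the bisector of its angle [gamma].  At first the
    distances to [A] and [B] decrease at rate [rho / 2 = cos (gamma / 2)], and the
    sum of these rates exceeds [1] exactly when [gamma < 2 * PI / 3].  The point
    at distance [t] is written with explicit weights, which are nonnegative for
    small [t], so it lies in the region. *)
Lemma vertex_not_min k a b c A B C :
  admissible k a b c -> model_triangle k a b c A B C ->
  -1 / 2 < angle_cos k b a c ->
  exists P, in_hull k A B C P /\ dist_sum k A B C P < a + b.
Proof.
intros Hadm Htri Hang.
destruct (triangle_chord k a b c A B C Htri) as [E12 [E13 E23]].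
destruct Htri as [HA [HB [HC _]]].
destruct Hadm as [Ha [Hb [Hc [I1 [I2 [I3 Hw]]]]]].
assert (Wa : short k a) by (apply short_of with (2 := Hw); lra).
assert (Wb : short k b) by (apply short_of with (2 := Hw); lra).
assert (Pa := sn_pos k a Ha Wa); assert (Pb := sn_pos k b Hb Wb).
assert (Hh := hinge_strict k b a c Hb Ha ltac:(lra) ltac:(lra) ltac:(lra)
  ltac:(replace ((b + a + c) / 2) with ((a + b + c) / 2) by field; auto)).
set (g := angle_cos k b a c) in *.
assert (Hg : hinge k b a c = sn k b * sn k a * g).
{ unfold g, angle_cos; field; lra. }
assert (Hg1 : g < 1).
{ apply (Rmult_lt_reg_l (sn k b * sn k a)); [apply Rmult_lt_0_compat |]; lra. }
set (rho := sqrt (2 + 2 * g)).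
assert (Erho : rho * rho = 2 + 2 * g) by (apply sqrt_sqrt; lra).
assert (Hrho : 1 < rho) by (rewrite <- sqrt_1; apply sqrt_lt_1; lra).
assert (Hrho2 : rho < 2) by nra.
(* any rate strictly between [1 / 2] and [rho / 2] would do *)
set (al := (1 + rho) / 4).
set (ra := / sn k a); set (rb := / sn k b).
assert (Ra : ra * sn k a = 1) by (apply Rinv_l; lra).
assert (Rb : rb * sn k b = 1) by (apply Rinv_l; lra).
assert (Hra : 0 < ra) by (apply Rinv_0_lt_compat; lra).
assert (Hrb : 0 < rb) by (apply Rinv_0_lt_compat; lra).
(* weight of [C] at distance [t]; those of [A], [B] are [u1], [u2] below *)
set (w3 := fun t => cs k t - sn k t / rho * (cs k a * ra + cs k b * rb)).
(* [ms] of the distance to a vertex at distance [s] from [C] *)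
set (target := fun s t => ms k s + ms k t - k * (ms k s * ms k t) -
  sn k s * sn k t * rho / 2).
(* the factor [t] turns positivity at [0] into a sign of derivative *)
destruct (derive_sign (fun t => t * w3 t) 1) as [d1 [Hd1 Q1]]; [| apply Rmult_0_l | lra |].
{ evar_last.
  { apply (is_derive_mult (K := R_AbsRing));
      [apply (is_derive_id (K := R_AbsRing)) | | intros; apply Rmult_comm].
    unfold w3; apply (is_derive_minus (V := R_NormedModule));
      [apply is_derive_cs |].
    apply (is_derive_scal_l (K := R_AbsRing) (V := R_NormedModule)
      (fun t => sn k t / rho)).
    apply (is_derive_ext (fun t => / rho * sn k t)); [intros; apply Rmult_comm |].
    apply is_derive_scal, is_derive_sn. }
  unfold w3; rewrite sn_0, cs_0; unfold plus, minus, mult, one, scal, opp, plus; simpl.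
  unfold mult; simpl; field; lra. }
assert (Hside : forall s, 0 < sn k s -> exists d, 0 < d /\ forall t, 0 < t < d ->
  target s t < ms k (s - al * t)).
{ intros s Hs.
  destruct (derive_sign (fun t => ms k (s - al * t) - target s t)
    (sn k s * (rho / 2 - al))) as [d [Hd Q]].
  - evar_last.
    { apply (is_derive_minus (V := R_NormedModule)).
      - apply (is_derive_comp (ms k) (fun t => s - al * t)).
        + apply is_derive_ms.
        + instantiate (1 := - al); auto_derive; [trivial | ring].
      - unfold target.
        apply (is_derive_minus (V := R_NormedModule)).
        + apply (is_derive_minus (V := R_NormedModule)).
          * apply (is_derive_plus (V := R_NormedModule));
              [apply (is_derive_const (V := R_NormedModule)) | apply is_derive_ms].
          * apply is_derive_scal, is_derive_scal, is_derive_ms.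
        + apply (is_derive_ext (fun t => sn k s * rho / 2 * sn k t));
            [intros; simpl; field |].
          apply is_derive_scal, is_derive_sn. }
    replace (s - al * 0) with s by ring.
    rewrite sn_0, cs_0; unfold scal, minus, plus, opp, zero; simpl.
    unfold mult; simpl; field.
  - unfold target; rewrite sn_0, ms_0; replace (s - al * 0) with s by ring; field.
  - apply Rmult_lt_0_compat; auto; unfold al; lra.
  - exists d; split; auto; intros t Ht; specialize (Q t Ht); lra. }
destruct (Hside a Pa) as [d2 [Hd2 Q2]]; destruct (Hside b Pb) as [d3 [Hd3 Q3]].
assert (exists t, 0 < t /\ t < d1 /\ t < d2 /\ t < d3 /\ t < a /\ t < b) as
  [t [Ht [Ht1 [Ht2 [Ht3 [Hta Htb]]]]]].
{ set (m := Rmin (Rmin d1 d2) (Rmin d3 (Rmin a b))).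
  assert (0 < m) by (unfold m; repeat apply Rmin_pos; auto).
  assert (M1 := Rmin_l (Rmin d1 d2) (Rmin d3 (Rmin a b))).
  assert (M2 := Rmin_r (Rmin d1 d2) (Rmin d3 (Rmin a b))).
  assert (M3 := Rmin_l d1 d2); assert (M4 := Rmin_r d1 d2).
  assert (M5 := Rmin_l d3 (Rmin a b)); assert (M6 := Rmin_r d3 (Rmin a b)).
  assert (M7 := Rmin_l a b); assert (M8 := Rmin_r a b); fold m in M1, M2.
  exists (m / 2); lra. }
specialize (Q1 t (conj Ht Ht1)); specialize (Q2 t (conj Ht Ht2)).
specialize (Q3 t (conj Ht Ht3)).
assert (Hw3 : 0 < w3 t) by (apply (Rmult_lt_reg_l t); lra).
assert (Wt : short k t) by (apply short_of with a; auto; lra).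
assert (Pt := sn_pos k t Ht Wt).
set (w := sn k t / rho) in *.
assert (Hwp : 0 < w) by (apply Rdiv_lt_0_compat; lra).
assert (Ew : w * rho = sn k t) by (unfold w; field; lra).
set (u1 := w * rb); set (u2 := w * ra); set (u3 := w3 t) in *.
assert (H1 : 0 < u1) by (apply Rmult_lt_0_compat; auto).
assert (H2 : 0 < u2) by (apply Rmult_lt_0_compat; auto).
assert (Sa := sn_ms_sqr k a); assert (Sb := sn_ms_sqr k b).
assert (St := sn_ms_sqr k t).
assert (Ca := cs_ms k a); assert (Cb := cs_ms k b); assert (Ct := cs_ms k t).
assert (Mc : ms k c = ms k a + ms k b - k * (ms k a * ms k b) -
  sn k b * sn k a * g) by (unfold hinge in Hg; lra).
set (sg := ms k a * ra + ms k b * rb).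
assert (EU : u1 + u2 + u3 = 1 - k * ms k t + k * (w * sg)).
{ unfold u1, u2, u3, w3, sg; fold w; rewrite Ca, Cb, Ct; ring. }
assert (Emid : u1 * ms k b + u2 * ms k a = w * sg) by (unfold u1, u2, sg; ring).
assert (F1 : ra ^ 2 * (2 * ms k a - k * ms k a ^ 2) = 1).
{ rewrite <- Sa; replace (ra ^ 2 * sn k a ^ 2) with ((ra * sn k a) ^ 2) by ring.
  rewrite Ra; ring. }
assert (F2 : rb ^ 2 * (2 * ms k b - k * ms k b ^ 2) = 1).
{ rewrite <- Sb; replace (rb ^ 2 * sn k b ^ 2) with ((rb * sn k b) ^ 2) by ring.
  rewrite Rb; ring. }
assert (F3 : ra * rb * ms k c =
  ra * rb * (ms k a + ms k b - k * (ms k a * ms k b)) - g).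
{ rewrite Mc.
  transitivity (ra * rb * (ms k a + ms k b - k * (ms k a * ms k b)) -
    (ra * sn k a) * (rb * sn k b) * g); [ring | rewrite Ra, Rb; ring]. }
assert (F4 : w ^ 2 * (2 + 2 * g) = 2 * ms k t - k * ms k t ^ 2).
{ rewrite <- St, <- Ew, <- Erho; ring. }
set (M := pairs (ms k c) (ms k b) (ms k a) u1 u2 u3).
assert (EM : 2 * M = (1 + (u1 + u2 + u3)) * (w * sg - ms k t)).
{ apply Rminus_diag_uniq.
  transitivity (w ^ 2 * (2 * (ra * rb * ms k c) - 2 * sg * (ra + rb) + k * sg ^ 2)
    + (2 * ms k t - k * ms k t ^ 2)).
  - replace M with (u1 * u2 * ms k c +
      (1 - k * ms k t + k * (w * sg) - u1 - u2) * (u1 * ms k b + u2 * ms k a))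
      by (rewrite <- EU; unfold M, pairs; ring).
    rewrite Emid, EU; unfold u1, u2; ring.
  - rewrite F3, <- F4.
    replace (2 * (ra * rb * (ms k a + ms k b - k * (ms k a * ms k b)) - g) -
      2 * sg * (ra + rb) + k * sg ^ 2) with
      (- 2 * g - ra ^ 2 * (2 * ms k a - k * ms k a ^ 2) -
       rb ^ 2 * (2 * ms k b - k * ms k b ^ 2)) by (unfold sg; ring).
    rewrite F1, F2; ring. }
assert (HU : 0 < u1 + u2 + u3) by lra.
assert (Hnorm : (u1 + u2 + u3) ^ 2 -
  2 * k * pairs (ms k c) (ms k b) (ms k a) u1 u2 u3 = 1).
{ fold M; replace (2 * k * M) with (k * (2 * M)) by ring; rewrite EM.
  rewrite EU; ring. }
assert (EQ : 2 * M / (1 + (u1 + u2 + u3)) = w * sg - ms k t).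
{ rewrite EM; field; lra. }
set (P := comb u1 u2 u3 A B C).
assert (HP : on_model k P).
{ apply (comb_on_model k A B C u1 u2 u3 (ms k c) (ms k b) (ms k a)); auto; lra. }
assert (PA : chord k P A = target b t).
{ unfold P; rewrite (chord_comb k A B C u1 u2 u3 (ms k c) (ms k b) (ms k a)); auto.
  fold M; rewrite EQ.
  replace u3 with (1 - k * ms k t + k * (w * sg) - u1 - u2) by lra.
  transitivity (ms k b + ms k t - k * (ms k b * ms k t) +
    w * (ra * ms k c - ms k b * (ra + rb) + k * (ms k b * sg) - sg));
    [unfold u1, u2; ring |].
  unfold target; rewrite <- Ew.
  replace (sn k b * (w * rho) * rho / 2) with (w * (sn k b * (rho * rho)) / 2)
    by field.
  rewrite Erho.
  replace (ra * ms k c) with (ra * (ms k a + ms k b - k * (ms k a * ms k b)) -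
    ra * sn k a * (sn k b * g)) by (rewrite Mc; ring).
  rewrite Ra.
  transitivity (ms k b + ms k t - k * (ms k b * ms k t) + w *
    (- (sn k b * g) - rb * (2 * ms k b - k * ms k b ^ 2)));
    [unfold sg; ring |].
  rewrite <- Sb; replace (rb * sn k b ^ 2) with (rb * sn k b * sn k b) by ring.
  rewrite Rb; field. }
assert (PB : chord k P B = target a t).
{ unfold P; rewrite comb_swap.
  assert (EP' : pairs (ms k c) (ms k a) (ms k b) u2 u1 u3 = M)
    by (unfold M, pairs; ring).
  rewrite (chord_comb k B A C u2 u1 u3 (ms k c) (ms k a) (ms k b)); auto;
    [| now rewrite chord_sym | lra | rewrite EP'; unfold M; lra].
  rewrite EP'; replace (u2 + u1 + u3) with (u1 + u2 + u3) by ring; rewrite EQ.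
  replace u3 with (1 - k * ms k t + k * (w * sg) - u1 - u2) by lra.
  transitivity (ms k a + ms k t - k * (ms k a * ms k t) +
    w * (rb * ms k c - ms k a * (ra + rb) + k * (ms k a * sg) - sg));
    [unfold u1, u2; ring |].
  unfold target; rewrite <- Ew.
  replace (sn k a * (w * rho) * rho / 2) with (w * (sn k a * (rho * rho)) / 2)
    by field.
  rewrite Erho.
  replace (rb * ms k c) with (rb * (ms k a + ms k b - k * (ms k a * ms k b)) -
    rb * sn k b * (sn k a * g)) by (rewrite Mc; ring).
  rewrite Rb.
  transitivity (ms k a + ms k t - k * (ms k a * ms k t) + w *
    (- (sn k a * g) - ra * (2 * ms k a - k * ms k a ^ 2)));
    [unfold sg; ring |].
  rewrite <- Sa; replace (ra * sn k a ^ 2) with (ra * sn k a * sn k a) by ring.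
  rewrite Ra; field. }
assert (PC : chord k P C = ms k t).
{ unfold P; rewrite comb_rot.
  assert (EP' : pairs (ms k b) (ms k a) (ms k c) u3 u1 u2 = M)
    by (unfold M, pairs; ring).
  rewrite (chord_comb k C A B u3 u1 u2 (ms k b) (ms k a) (ms k c)); auto;
    [| now rewrite chord_sym | now rewrite chord_sym | lra
     | rewrite EP'; unfold M; lra].
  rewrite EP'; replace (u3 + u1 + u2) with (u1 + u2 + u3) by ring; rewrite EQ.
  lra. }
exists P; split.
{ split; auto; exists u1, u2, u3; repeat split; auto; lra. }
destruct (model_dist_spec k P A HP HA) as [X1 [Y1 Z1]].
destruct (model_dist_spec k P B HP HB) as [X2 [Y2 Z2]].
destruct (model_dist_spec k P C HP HC) as [X3 [Y3 Z3]].
rewrite PA in Z1; rewrite PB in Z2; rewrite PC in Z3.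
rewrite <- Z1 in Q3; rewrite <- Z2 in Q2.
assert (Hal : al * t < t) by (unfold al; nra).
apply ms_lt_inv in Q3; auto; [| lra].
apply ms_lt_inv in Q2; auto; [| lra].
apply ms_inj in Z3; auto; [| lra | now apply short_weak].
unfold dist_sum; rewrite Z3.
assert (t < 2 * (al * t)) by (unfold al; nra).
lra.
Qed.

(** * Strict monotonicity of [S] *)

Lemma admissible_curvature k k' a b c : k <= k' ->
  admissible k' a b c -> admissible k a b c.
Proof.
intros Hk [Ha [Hb [Hc [H1 [H2 [H3 Hw]]]]]]; repeat split; auto.
apply short_curvature with k'; auto; lra.
Qed.

Lemma admissible_perimeter k a b c A B C : admissible k a b c ->
  model_triangle k a b c A B C -> 0 < k -> perimeter k A B C < 2 * PI / sqrt k.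
Proof.
intros Hadm [_ [_ [_ [Ea [Eb Ec]]]]] Hk; unfold perimeter; rewrite Ea, Eb, Ec.
destruct Hadm as [_ [_ [_ [_ [_ [_ Hw]]]]]]; specialize (Hw Hk).
apply Rlt_div_r; [apply sqrt_lt_R0; auto | lra].
Qed.

(** The perimeter being less than a great circle, the region is the geodesic hull
    of the vertices. *)
Lemma is_S_hull k a b c s : admissible k a b c -> is_S a b c k s ->
  exists A B C, model_triangle k a b c A B C /\
    (exists P, in_hull k A B C P /\ dist_sum k A B C P = s) /\
    (forall P, in_hull k A B C P -> s <= dist_sum k A B C P).
Proof.
intros Hadm [A [B [C [D [HA [HB [HC [Ea [Eb [Ec [Hreg [Hex Hmin]]]]]]]]]]]].
assert (Htri : model_triangle k a b c A B C) by (unfold model_triangle; auto 10).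
exists A, B, C; split; auto.
destruct Hreg as [_ | N Hk Hper]; auto.
assert (Hlt := admissible_perimeter k a b c A B C Hadm Htri Hk); lra.
Qed.

Lemma is_S_exists k a b c : admissible k a b c -> exists s, is_S a b c k s.
Proof.
intros Hadm; destruct (triangle_exists k a b c Hadm) as [A [B [C Htri]]].
destruct (min_dist_sum_exists k a b c A B C Hadm Htri) as [P [HP Hmin]].
assert (Hper := admissible_perimeter k a b c A B C Hadm Htri).
destruct Htri as [HA [HB [HC [Ea [Eb Ec]]]]].
exists (dist_sum k A B C P), A, B, C, (in_hull k A B C).
do 6 (split; [assumption |]); split; [now apply region_hull |].
split; [exists P |]; auto.
Qed.

Lemma S_fin_spec k a b c : admissible k a b c -> is_S a b c k (S_fin a b c k).
Proof. intros H; unfold S_fin; apply epsilon_spec, is_S_exists; auto. Qed.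

(** Half the sum of three triangle inequalities, or [c <= a + b] when the minimum
    is at least [a + b]. *)
Lemma is_S_half_perimeter k a b c s : admissible k a b c -> a <= b -> b <= c ->
  is_S a b c k s -> (a + b + c) / 2 <= s.
Proof.
intros Hadm Hab Hbc HS.
destruct (is_S_hull k a b c s Hadm HS) as [A [B [C [Htri [[P [[HP _] <-]] _]]]]].
destruct (vertex_or_generic k a b c A B C P Hadm Hab Hbc Htri HP) as [_ H].
destruct Hadm as [Ha [Hb [Hc [H1 [H2 [H3 _]]]]]].
unfold dist_sum, triangle_ineq in *; lra.
Qed.

(** The two ways of beating a minimum point of the triangle of curvature [k2]
    in the triangle of curvature [k1]: Kirszbraun at a generic point, and the
    angle condition when that point is a vertex, or the antipode of one. *)
Lemma is_S_lt k1 k2 a b c s1 s2 :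
  admissible k2 a b c -> a <= b -> b <= c -> k1 < k2 ->
  -1 / 2 <= angle_cos k2 b a c -> is_S a b c k1 s1 -> is_S a b c k2 s2 -> s1 < s2.
Proof.
intros Hadm Hab Hbc Hk Hang HS1 HS2.
assert (Hadm1 := admissible_curvature k1 k2 a b c (Rlt_le _ _ Hk) Hadm).
destruct (is_S_hull k1 a b c s1 Hadm1 HS1) as [A [B [C [Htri [_ Hmin]]]]].
destruct (is_S_hull k2 a b c s2 Hadm HS2)
  as [A' [B' [C' [Htri' [[P [[HP _] <-]] _]]]]].
destruct (vertex_or_generic k2 a b c A' B' C' P Hadm Hab Hbc Htri' HP)
  as [Hform [Hfar | [[P1 [P2 P3]] [[W1 [W2 W3]] [T1 [T2 T3]]]]]].
- destruct Hadm as [Ha [Hb [Hc [H1 [H2 [H3 Hw]]]]]].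
  destruct (angle_cos_mono k1 k2 b a c) as [M1 M2]; auto; try lra;
    try (apply short_of with (2 := Hw); lra).
  destruct (vertex_not_min k1 a b c A B C Hadm1 Htri) as [Q [HQ Hlt]].
  { destruct M1 as [M1 | M1]; [lra |].
    destruct (M2 M1) as [E | [E | E]]; lra. }
  specialize (Hmin Q HQ); unfold dist_sum in *; lra.
- destruct (kirszbraun_triangle k1 k2 a b c A B C (model_dist k2 P A') (model_dist k2 P B')
    (model_dist k2 P C')) as [Q [HQ Hlt]]; auto.
  specialize (Hmin Q HQ); unfold dist_sum in *; lra.
Qed.

(** * The bound [Lambda] *)

(** At curvature [Lambda] the largest angle is [2 * PI / 3].  It is not [PI], so
    the triangle is not a great circle. *)
Lemma lambda_admissible k a b c : 0 < a -> a <= b -> b <= c -> c < a + b ->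
  short_le k ((a + b + c) / 2) ->
  hinge k b a c = - / 2 * (sn k a * sn k b) ->
  admissible k a b c /\ angle_cos k b a c = -1 / 2.
Proof.
intros Ha Hab Hbc Hc Hw E.
assert (Wa : short k a) by (apply short_of_lt with (2 := Hw); lra).
assert (Wb : short k b) by (apply short_of_lt with (2 := Hw); lra).
assert (Pa : 0 < sn k a) by (apply sn_pos; auto).
assert (Pb : 0 < sn k b) by (apply sn_pos; auto; lra).
split.
- repeat split; try lra; apply sn_zero_cases; auto; [lra |].
  intros H0; assert (Hadd := hinge_add k b a c).
  replace ((b + a + c) / 2) with ((a + b + c) / 2) in Hadd by field.
  rewrite H0, E in Hadd.
  assert (0 < sn k a * sn k b) by (apply Rmult_lt_0_compat; auto); lra.
- unfold angle_cos; rewrite E; field; lra.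
Qed.

Lemma hinge_cs k x y d : k * hinge k x y d = cs k d - cs k x * cs k y.
Proof. unfold hinge; rewrite !cs_ms; ring. Qed.

Lemma is_Lambda_spec a b c L : 0 < a -> a <= b -> b <= c -> c < a + b ->
  is_Lambda a b c L ->
  exists k, L = Finite k /\ admissible k a b c /\ angle_cos k b a c = -1 / 2.
Proof.
intros Ha Hab Hbc Hc [E | _ E | k _ _ Hk E | k _ _ Hk E].
- lra.
- exists 0; split; auto; apply lambda_admissible; auto; [intros H; lra |].
  unfold hinge, ms, sn; destruct (Rlt_dec 0 0) as [|_]; lra.
- exists k; split; auto; apply lambda_admissible; auto.
  + intros _; assert (Hs : sqrt k <= 2 * PI / (a + b + c)).
    { assert (Hpi := PI_RGT_0).
      rewrite <- (sqrt_pow2 (2 * PI / (a + b + c)));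
        [apply sqrt_le_1; lra | apply Rdiv_le_0_compat; lra]. }
    apply (Rle_div_r _ _ (a + b + c)) in Hs; lra.
  + apply (Rmult_eq_reg_l k); [| lra]; rewrite hinge_cs.
    unfold cs, sn; destruct (Rlt_dec 0 k) as [Hk'|]; [| lra]; sqrt_facts k.
    rewrite E; transitivity (- / 2 * (sqrt k * sqrt k) *
      (sin (a * sqrt k) / sqrt k * (sin (b * sqrt k) / sqrt k)));
      [field; lra | rewrite H0; ring].
- exists k; split; auto; apply lambda_admissible; auto; [intros H; lra |].
  apply (Rmult_eq_reg_l k); [| lra]; rewrite hinge_cs.
  unfold cs, sn; destruct (Rlt_dec 0 k) as [|_]; [lra |].
  destruct (Rlt_dec k 0) as [_|]; [| lra]; sqrt_facts k.
  rewrite E; transitivity (/ 2 * (sqrt (- k) * sqrt (- k)) *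
    (sinh (a * sqrt (- k)) / sqrt (- k) * (sinh (b * sqrt (- k)) / sqrt (- k))));
    [field; lra | rewrite H0; ring].
Qed.

(** Near [0] the difference of the two sides of the equation for [Lambda] vanishes
    to second order, so its leading coefficient decides its sign; [S] stands for
    [sin] or [sinh]. *)
Lemma second_order_sign (S : R -> R) (al be a b p q : R) :
  S 0 = 0 -> is_derive S 0 1 -> 0 < al * (a * b) - be * (p * q) ->
  exists d, 0 < d /\ forall r, 0 < r < d ->
    0 < al * (S (a * r) * S (b * r)) - be * (S (p * r) * S (q * r)).
Proof.
intros S0 S1 Hpos.
assert (Hlim : forall x, is_lim (fun r => S (x * r) / r) 0 x).
{ intros x; assert (D : is_derive (fun r => S (x * r)) 0 x).
  { evar_last.
    { apply (is_derive_comp S (fun r => x * r)).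
      - rewrite Rmult_0_r; exact S1.
      - auto_derive; [trivial | reflexivity]. }
    simpl; unfold scal; simpl; unfold mult; simpl; ring. }
  apply is_derive_Reals in D; apply is_lim_spec; intros eps.
  destruct (D eps (cond_pos eps)) as [d Hd]; exists d; intros y By Hy.
  assert (By' : Rabs y < d) by (rewrite <- (Rminus_0_r y); exact By).
  specialize (Hd y Hy By'); rewrite Rplus_0_l, Rmult_0_r, S0, Rminus_0_r in Hd.
  exact Hd. }
assert (L : is_lim (fun r => al * (S (a * r) / r * (S (b * r) / r)) -
  be * (S (p * r) / r * (S (q * r) / r))) 0 (al * (a * b) - be * (p * q))).
{ apply (is_lim_minus' _ _ _ (al * (a * b)) (be * (p * q))).
  - apply (is_lim_scal_l _ al _ (a * b)), (is_lim_mult _ _ _ a b); simpl; auto.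
  - apply (is_lim_scal_l _ be _ (p * q)), (is_lim_mult _ _ _ p q); simpl; auto. }
apply is_lim_spec in L.
destruct (L (mkposreal _ Hpos)) as [d Hd]; exists d; split; [apply cond_pos |].
intros r Hr.
assert (Hb : ball 0 d r).
{ change (Rabs (r - 0) < d); rewrite Rminus_0_r, Rabs_pos_eq; lra. }
specialize (Hd r Hb ltac:(lra)); simpl in Hd; apply Rabs_lt_between in Hd.
replace (al * _ - _) with (r ^ 2 * (al * (S (a * r) / r * (S (b * r) / r)) -
  be * (S (p * r) / r * (S (q * r) / r)))) by (field; lra).
apply Rmult_lt_0_compat; [apply pow_lt |]; lra.
Qed.

(** Intermediate values in [r = sqrt (Rabs k)], between small [r], where the sign
    is decided by that of [a ^ 2 + b ^ 2 + a * b - c ^ 2], and a second point: the maximal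
    perimeter for [k > 0], where the angle is [PI]; large [r] for [k < 0], where
    [c < a + b] makes the term [exp ((a + b) * r)] dominate. *)
Lemma is_Lambda_exists a b c : 0 < a -> a <= b -> b <= c -> c <= a + b ->
  exists L, is_Lambda a b c L.
Proof.
intros Ha Hab Hbc [Hc | Hc]; [| exists m_infty; now constructor].
set (p := (a + c - b) / 2); set (q := (b + c - a) / 2).
destruct (Rtotal_order (c ^ 2) (a ^ 2 + b ^ 2 + a * b)) as [H | [H | H]].
- set (f := fun r => - (cos (c * r) - (cos (a * r) * cos (b * r)
      - / 2 * (sin (a * r) * sin (b * r))))).
  assert (Hf : forall r, f r =
    - (3 / 2 * (sin (a * r) * sin (b * r)) - 2 * (sin (p * r) * sin (q * r)))).
  { intros r; unfold f.
    assert (E1 := cos_minus (p * r) (q * r)); assert (E2 := cos_plus (p * r) (q * r)).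
    assert (E3 := cos_minus (a * r) (b * r)).
    replace (p * r + q * r) with (c * r) in E2 by (unfold p, q; field).
    replace (p * r - q * r) with (a * r - b * r) in E1 by (unfold p, q; field).
    lra. }
  destruct (second_order_sign sin (3 / 2) 2 a b p q) as [d [Hd Hs]].
  + apply sin_0.
  + rewrite <- cos_0; apply is_derive_Reals, derivable_pt_lim_sin.
  + unfold p, q; lra.
  + assert (Hpi := PI_RGT_0); set (r1 := 2 * PI / (a + b + c)).
    assert (Hr1 : 0 < r1) by (apply Rdiv_lt_0_compat; lra).
    assert (Er1 : (a + b + c) * r1 = 2 * PI) by (unfold r1; field; lra).
    assert (Hr0 : exists r0, 0 < r0 < d /\ r0 < r1).
    { exists (Rmin d r1 / 2); assert (M1 := Rmin_l d r1); assert (M2 := Rmin_r d r1).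
      assert (0 < Rmin d r1) by (apply Rmin_pos; auto); lra. }
    destruct Hr0 as [r0 [Hr0 Hr01]].
    assert (Hang : forall x, 0 < x -> 2 * x < a + b + c -> 0 < sin (x * r1)).
    { intros x Hx Hx2; apply sin_gt_0; [apply Rmult_lt_0_compat; auto |].
      assert (2 * x * r1 < (a + b + c) * r1) by (apply Rmult_lt_compat_r; auto).
      lra. }
    destruct (IVT f r0 r1) as [r [Hr Er]]; auto.
    * unfold f; intros x; reg.
    * rewrite Hf; specialize (Hs r0 Hr0); lra.
    * unfold f; replace (c * r1) with (- (a * r1 + b * r1) + 2 * PI) by lra.
      rewrite cos_plus, cos_2PI, sin_2PI, cos_neg, cos_plus.
      assert (0 < sin (a * r1) * sin (b * r1))
        by (apply Rmult_lt_0_compat; apply Hang; lra).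
      lra.
    * assert (Es : sqrt (r ^ 2) = r) by (apply sqrt_pow2; lra).
      exists (Finite (r ^ 2)); apply Lambda_pos; auto.
      -- split; [apply pow_lt; lra | apply pow_incr; unfold r1 in Hr; lra].
      -- rewrite Es; unfold f in Er; lra.
- exists (Finite 0); now constructor.
- set (f := fun r => - (cosh (c * r) - (cosh (a * r) * cosh (b * r)
      + / 2 * (sinh (a * r) * sinh (b * r))))).
  assert (Hf : forall r, f r =
    - (- (3 / 2) * (sinh (a * r) * sinh (b * r)) - -2 * (sinh (p * r) * sinh (q * r)))).
  { intros r; unfold f.
    assert (E2 := cosh_plus (p * r) (q * r)).
    assert (E1 := cosh_plus (p * r) (- (q * r))).
    assert (E3 := cosh_plus (a * r) (- (b * r))).
    assert (Co : forall x, cosh (- x) = cosh x)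
      by (intros x; unfold cosh; rewrite Ropp_involutive; field).
    assert (So : forall x, sinh (- x) = - sinh x)
      by (intros x; unfold sinh; rewrite Ropp_involutive; field).
    rewrite Co, So in E1, E3.
    replace (p * r + q * r) with (c * r) in E2 by (unfold p, q; field).
    replace (p * r + - (q * r)) with (a * r + - (b * r)) in E1 by (unfold p, q; field).
    lra. }
  destruct (second_order_sign sinh (- (3 / 2)) (-2) a b p q) as [d [Hd Hs]].
  + apply sinh_0.
  + rewrite <- cosh_0; apply is_derive_Reals, derivable_pt_lim_sinh.
  + unfold p, q; lra.
  + set (r1 := 4 / (a + b - c)).
    assert (Hr1 : 0 < r1) by (apply Rdiv_lt_0_compat; lra).
    assert (Er1 : (a + b - c) * r1 = 4) by (unfold r1; field; lra).
    assert (Hr0 : exists r0, 0 < r0 < d /\ r0 < r1).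
    { exists (Rmin d r1 / 2); assert (M1 := Rmin_l d r1); assert (M2 := Rmin_r d r1).
      assert (0 < Rmin d r1) by (apply Rmin_pos; auto); lra. }
    destruct Hr0 as [r0 [Hr0 Hr01]].
    destruct (IVT f r0 r1) as [r [Hr Er]]; auto.
    * unfold f, cosh, sinh; intros x; reg.
    * rewrite Hf; specialize (Hs r0 Hr0); lra.
    * assert (Sa : 0 < sinh (a * r1)) by (apply sinh_pos, Rmult_lt_0_compat; auto).
      assert (Sb : 0 < sinh (b * r1)) by (apply sinh_pos, Rmult_lt_0_compat; lra).
      assert (Sab := Rmult_lt_0_compat _ _ Sa Sb).
      assert (B1 : cosh (c * r1) <= exp (c * r1)).
      { assert (0 < sinh (c * r1)) by (apply sinh_pos, Rmult_lt_0_compat; lra).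
        unfold cosh, sinh in *; lra. }
      assert (Cge : forall x, exp x / 2 <= cosh x).
      { intros x; unfold cosh; assert (Hx := exp_pos (- x)); lra. }
      assert (B2 : exp (a * r1) / 2 * (exp (b * r1) / 2) <=
        cosh (a * r1) * cosh (b * r1)).
      { assert (X1 := exp_pos (a * r1)); assert (X2 := exp_pos (b * r1)).
        apply Rmult_le_compat; auto; lra. }
      assert (B3 : exp (a * r1) * exp (b * r1) = exp (c * r1) * exp 4).
      { rewrite <- !exp_plus; f_equal; lra. }
      assert (B4 : 4 < exp 4) by (assert (H4 := exp_ineq1 4 ltac:(lra)); lra).
      assert (B5 : exp (c * r1) * 4 < exp (c * r1) * exp 4)
        by (apply Rmult_lt_compat_l; [apply exp_pos | auto]).
      unfold f; lra.
    * assert (Es : sqrt (- - r ^ 2) = r)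
        by (rewrite Ropp_involutive; apply sqrt_pow2; lra).
      exists (Finite (- r ^ 2)); apply Lambda_neg; auto; try lra.
      -- assert (0 < r ^ 2) by (apply pow_lt; lra); lra.
      -- rewrite Es; unfold f in Er; lra.
Qed.

Lemma Lambda_eq_m_infty a b c : c = a + b -> Lambda a b c = m_infty.
Proof.
intros E; assert (H : is_Lambda a b c (Lambda a b c)).
{ unfold Lambda; apply epsilon_spec; exists m_infty; now constructor. }
destruct H; auto; lra.
Qed.

(** * Curvature of triples *)

(** Below a finite curvature there is always another finite one, at which [S]
    is at least the half perimeter; this settles the value at [m_infty]. *)
Lemma S_ext_strict_mono a b c k k' :
  0 < a -> a <= b -> b <= c -> c <= a + b ->
  Rbar_le k' (Lambda a b c) -> Rbar_lt k k' -> S_ext a b c k < S_ext a b c k'.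
Proof.
intros Ha Hab Hbc Hc HL Hlt.
assert (HS : is_Lambda a b c (Lambda a b c)).
{ unfold Lambda; apply epsilon_spec, is_Lambda_exists; auto. }
destruct Hc as [Hc | Hc].
2: { rewrite (Lambda_eq_m_infty a b c Hc) in HL.
     destruct k', k; simpl in *; contradiction. }
destruct (is_Lambda_spec a b c _ Ha Hab Hbc Hc HS) as [l [El [Al Cl]]].
rewrite El in HL; destruct k' as [k' | |]; simpl in HL; try contradiction.
2: { destruct k; contradiction. }
assert (Hadm := admissible_curvature k' l a b c HL Al).
assert (Hang : -1 / 2 <= angle_cos k' b a c).
{ destruct HL as [HL | ->]; [| lra].
  destruct Al as [_ [Hb [_ [_ [_ [_ Hw]]]]]].
  rewrite <- Cl; apply angle_cos_mono; auto; try lra;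
    apply short_of with (2 := Hw); lra. }
assert (Hfin : forall r, r < k' -> S_fin a b c r < S_fin a b c k').
{ intros r Hr; apply (is_S_lt r k' a b c); auto using S_fin_spec.
  apply S_fin_spec, admissible_curvature with k'; auto; lra. }
destruct k as [k | |]; simpl in *; try contradiction; auto.
apply Rle_lt_trans with (2 := Hfin (k' - 1) ltac:(lra)).
assert (Hadm' := admissible_curvature (k' - 1) k' a b c ltac:(lra) Hadm).
apply (is_S_half_perimeter (k' - 1)); auto using S_fin_spec.
Qed.

Lemma Glb_Rbar_subset_le (E F : R -> Prop) x :
  (forall s, E s -> F s) -> (forall s, F s -> 0 <= s) -> E x ->
  real (Glb_Rbar F) <= real (Glb_Rbar E).
Proof.
intros Hsub Hpos Hx.
destruct (Glb_Rbar_correct E) as [E1 E2]; destruct (Glb_Rbar_correct F) as [F1 F2].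
assert (HE : Rbar_le 0 (Glb_Rbar E)) by (apply E2; intros s Hs; apply Hpos; auto).
assert (HF : Rbar_le 0 (Glb_Rbar F)) by (apply F2; intros s Hs; apply Hpos; auto).
assert (HFE : Rbar_le (Glb_Rbar F) (Glb_Rbar E)) by (apply E2; intros s Hs; apply F1; auto).
assert (HEx := E1 x Hx).
destruct (Glb_Rbar E), (Glb_Rbar F); simpl in *; try contradiction; auto; lra.
Qed.

Lemma g_inf_embedding (X Y : Metric_Space) (f : Base X -> Base Y)
  (Hf : isometric_embedding X Y f) (T : metric_triple X) :
  g_inf Y (image_triple X Y f Hf T) <= g_inf X T.
Proof.
unfold g_inf; simpl; eapply Glb_Rbar_subset_le.
- intros s [x ->]; exists (f x); now rewrite !Hf.
- intros s [y ->].
  assert (H1 := dist_pos Y (f (pt1 T)) y); assert (H2 := dist_pos Y (f (pt2 T)) y).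
  assert (H3 := dist_pos Y (f (pt3 T)) y); lra.
- exists (pt1 T); reflexivity.
Qed.

Theorem proposition4p7
  (X Y : Metric_Space) (f : Base X -> Base Y)
  (Hf : isometric_embedding X Y f)
  (T : metric_triple X) (kX kY : Rbar)
  (HkX : is_curvature X T kX)
  (HkY : is_curvature Y (image_triple X Y f Hf T) kY) :
  Rbar_le kY kX.
Proof.
destruct HkX as [_ EX], HkY as [LY EY]; simpl in LY, EY; rewrite !Hf in LY, EY.
assert (Hg := g_inf_embedding X Y f Hf T); rewrite EX, EY in Hg.
apply Rbar_not_lt_le; intros Hlt.
assert (Hd : 0 < dist X (pt1 T) (pt2 T)).
{ destruct (dist_pos X (pt1 T) (pt2 T)) as [|E]; auto.
  destruct (pt12_neq T); apply (dist_refl X); lra. }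
assert (H := S_ext_strict_mono _ _ _ kX kY Hd (d12_le_d23 T) (d23_le_d13 T)
  (dist_tri X (pt1 T) (pt3 T) (pt2 T)) LY Hlt).
lra.
Qed.
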